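(* Let $K \subset \mathbb{R}^d$ be a convex body with centroid $\mathrm{c}(K) = \boldsymbol{0}$. Then $$\#(K \cap \mathbb{Z}^d) < 2^d \left( \frac{2}{\lambda_1(K)} + 1 \right)^d.$$
   Context: A convex body in $\mathbb{R}^d$ is a compact convex set; here it has positive Lebesgue measure, so that its centroid is defined. The centroid of a Lebesgue measurable set $A \subset \mathbb{R}^d$ of positive Lebesgue measure $\mathrm{vol}(A)$ is $\mathrm{c}(A) = \frac{1}{\mathrm{vol}(A)} \int_A \boldsymbol{x} \, \mathrm{d}\boldsymbol{x}$. For a convex body $K$ with $\boldsymbol{0}$ in its interior (which is the case when $\mathrm{c}(K)=\boldsymbol{0}$), the first successive minimum is $$\lambda_1(K) = \min\{\lambda \in \mathbb{R}_{>0} : \lambda K \cap \mathbb{Z}^d \neq \{\boldsymbol{0}\}\}.$$ *)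

(* Defs.v *)
From HB Require Import structures.
From mathcomp Require Import all_boot all_order all_algebra.
From mathcomp Require Import all_classical all_reals all_analysis.

Set Implicit Arguments.
Unset Strict Implicit.
Unset Printing Implicit Defensive.

Import Order.TTheory GRing.Theory Num.Theory.
Import numFieldNormedType.Exports.

Local Open Scope classical_set_scope.
Local Open Scope ring_scope.

Section rV_measurable.
Variables (R : realType) (n : nat).

Definition rV_coord (i : 'I_n) (x : 'rV[R]_n) : R := x ord0 i.

(* This is the Borel sigma-algebra: 'rV[R]_n is second countable. *)
Definition rV_measurable : set (set 'rV[R]_n) := g_sigma_preimage rV_coord.

Let rV_measurable0 : rV_measurable set0.
Proof. exact: sigma_algebra0. Qed.

Let rV_measurableC A : rV_measurable A -> rV_measurable (~` A).
Proof. exact: sigma_algebraC. Qed.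

Let rV_measurable_bigcup (F : (set 'rV[R]_n)^nat) :
  (forall i, rV_measurable (F i)) -> rV_measurable (\bigcup_i F i).
Proof. exact: sigma_algebra_bigcup. Qed.

HB.instance Definition _ :=
  @isMeasurable.Build (measure_tuple_display default_measure_display)
    'rV[R]_n rV_measurable rV_measurable0 rV_measurableC rV_measurable_bigcup.

Lemma measurable_rV_coord (i : 'I_n) :
  measurable_fun [set: 'rV[R]_n] (fun x => x ord0 i).
Proof.
move=> _ Y mY; rewrite setTI; apply: sub_sigma_algebra => /=.
rewrite -bigcup_seq/=; exists i => /=; first by rewrite mem_index_enum.
by exists Y => //; rewrite setTI.
Qed.

Lemma measurable_fun_rVP d (T : measurableType d) (f : T -> 'rV[R]_n) :
  (forall i, measurable_fun [set: T] (fun t => f t ord0 i)) ->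
  measurable_fun [set: T] f.
Proof.
move=> mf.
suff H : g_sigma_preimage (fun i => rV_coord i \o f) `<=` @measurable _ T.
  move=> _ A mA; apply: H; rewrite g_sigma_preimage_comp.
  by exists A.
apply: smallest_sub; first exact: sigma_algebra_measurable.
rewrite -bigcup_seq; apply: bigcup_sub => i _ A [B mB <-].
exact: mf.
Qed.

End rV_measurable.

Definition rV_cons (R : realType) (n : nat) (p : R * 'rV[R]_n) : 'rV[R]_n.+1 :=
  row_mx p.1%:M p.2.

(* Lebesgue measure on R^n, as the n-fold product of the one-dimensional one
   (see lebesgue_rV_box). *)
Fixpoint lebesgue_rV {R : realType} {n : nat} : set 'rV[R]_n -> \bar R :=
  match n with
  | 0 => \d_(0 : 'rV[R]_0)
  | n'.+1 => pushforward (lebesgue_measure \x @lebesgue_rV R n')%E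
                         (@rV_cons R n')
  end.

Section rV_cons_theory.
Variables (R : realType) (n : nat).

Lemma rV_cons0 (p : R * 'rV[R]_n) : rV_cons p ord0 ord0 = p.1.
Proof.
rewrite /rV_cons (_ : ord0 = lshift n (ord0 : 'I_1)); last exact: val_inj.
by rewrite (@row_mxEl _ 1 1 n) mxE eqxx mulr1n.
Qed.

Lemma rV_consS (p : R * 'rV[R]_n) (i : 'I_n) :
  rV_cons p ord0 (lift ord0 i) = p.2 ord0 i.
Proof.
rewrite /rV_cons (_ : lift ord0 i = rshift 1 i); last exact: val_inj.
by rewrite (@row_mxEr _ 1 1 n).
Qed.

Lemma measurable_rV_cons : measurable_fun [set: R * 'rV[R]_n] (@rV_cons R n).
Proof.
apply: measurable_fun_rVP => i; have [j ->|->] := unliftP ord0 i.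
  under eq_fun do rewrite rV_consS.
  exact: (measurableT_comp (measurable_rV_coord j) measurable_snd).
under eq_fun do rewrite rV_cons0; exact: measurable_fst.
Qed.

Lemma rV_cons_surj (x : 'rV[R]_n.+1) :
  rV_cons (x ord0 ord0, \row_j x ord0 (lift ord0 j)) = x.
Proof.
apply/rowP => i; have [j ->|->] := unliftP ord0 i; last by rewrite rV_cons0.
by rewrite rV_consS mxE.
Qed.

End rV_cons_theory.

Section lebesgue_rV_step.
Variables (R : realType) (n : nat).
Variable mu : {sigma_finite_measure set 'rV[R]_n -> \bar R}.
Local Open Scope ereal_scope.

Let step : set 'rV[R]_n.+1 -> \bar R :=
  pushforward (lebesgue_measure \x mu) (@rV_cons R n).

Let step0 : step set0 = 0.
Proof. by rewrite /step /pushforward preimage_set0 measure0. Qed.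

Let step_ge0 A : 0 <= step A.
Proof.
exact: (@measure_ge0 _ _ _ (lebesgue_measure \x mu : {measure set _ -> \bar R})).
Qed.

Let step_sigma_additive : semi_sigma_additive step.
Proof.
have mcons A : measurable A -> measurable (@rV_cons R n @^-1` A).
  by move=> mA; rewrite -[_ @^-1` _]setTI; exact: measurable_rV_cons.
move=> F mF tF mUF; rewrite /step /pushforward preimage_bigcup.
apply: (@measure_semi_sigma_additive _ _ _ (lebesgue_measure \x mu)).
- by move=> k; exact: mcons.
- apply/trivIsetP => /= i j _ _ ij; rewrite -preimage_setI.
  by move/trivIsetP : tF => /(_ _ _ _ _ ij) ->//; rewrite preimage_set0.
- by rewrite -preimage_bigcup; exact: mcons.
Qed.

Let step_sigma_finite : sigma_finite setT step.
Proof.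
have [F FT Foo] : sigma_finite setT (lebesgue_measure \x mu).
  have /sigma_finiteP[A [TA ndA Aoo]] := sigma_finiteT (@lebesgue_measure R).
  have /sigma_finiteP[B [TB ndB Boo]] := sigma_finiteT mu.
  exists (fun k => A k `*` B k) => [|k].
    rewrite -setXTT TA TB predeqE => -[x y]; split=> [[/= [i _ Aix] [j _ Bjy]]|].
      exists (maxn i j) => //; split.
      - by move: x Aix; exact/subsetPset/ndA/leq_maxl.
      - by move: y Bjy; exact/subsetPset/ndB/leq_maxr.
    by move=> [i _ [/= ? ?]]; split; exists i.
  have [? ?] := Aoo k; have [? ?] := Boo k; split; first exact: measurableX.
  by rewrite product_measure1E// lte_mul_pinfty// ge0_fin_numE.
pose g (x : 'rV[R]_n.+1) := (x ord0 ord0, \row_j x ord0 (lift ord0 j)).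
have mg : measurable_fun setT g.
  apply: measurable_fun_pair; first exact: measurable_rV_coord.
  apply: measurable_fun_rVP => i.
  under eq_fun do rewrite mxE; exact: measurable_rV_coord.
have gK p : g (rV_cons p) = p.
  case: p => a v; congr pair; first by rewrite rV_cons0.
  by apply/rowP => i; rewrite mxE rV_consS.
exists (fun k => g @^-1` F k).
  by rewrite -preimage_bigcup -FT preimage_setT.
move=> k; have [mF Fk] := Foo k; split.
  by rewrite -[_ @^-1` _]setTI; exact: mg.
rewrite /step /pushforward -comp_preimage.
by rewrite (_ : g \o _ = id) // funeqE => p /=; rewrite gK.
Qed.

Lemma lebesgue_rV_step :
  exists nu : {sigma_finite_measure set 'rV[R]_n.+1 -> \bar R},
    nu = pushforward (lebesgue_measure \x mu) (@rV_cons R n) :> (set _ -> _).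
Proof.
pose m := isMeasure.Build _ _ _ step step0 step_ge0 step_sigma_additive.
pose mstep : {measure set _ -> \bar R} := HB.pack step m.
pose sf := Measure_isSigmaFinite.Build _ _ _ mstep step_sigma_finite.
pose nu : {sigma_finite_measure set _ -> \bar R} := HB.pack step m sf.
by exists nu.
Qed.

End lebesgue_rV_step.

Section lebesgue_rV_measure.
Variables (R : realType).
Local Open Scope ereal_scope.

Lemma lebesgue_rV_sigma_finite_measure (n : nat) :
  exists mu : {sigma_finite_measure set 'rV[R]_n -> \bar R},
    mu = lebesgue_rV :> (set _ -> _).
Proof.
elim: n => [|n [mu IH]]; first by exists (\d_(0%R : 'rV[R]_0)).
by have [nu nuE] := lebesgue_rV_step mu; exists nu; rewrite nuE IH.
Qed.

Variable n : nat.
Let mu : set 'rV[R]_n -> \bar R := lebesgue_rV.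

Let mu0 : mu set0 = 0.
Proof.
by rewrite /mu; have [m <-] := lebesgue_rV_sigma_finite_measure n.
Qed.

Let mu_ge0 A : 0 <= mu A.
Proof.
by rewrite /mu; have [m <-] := lebesgue_rV_sigma_finite_measure n.
Qed.

Let mu_sigma_additive : semi_sigma_additive mu.
Proof.
rewrite /mu; have [m <-] := lebesgue_rV_sigma_finite_measure n.
exact: measure_semi_sigma_additive.
Qed.

HB.instance Definition _ := isMeasure.Build _ _ _ (@lebesgue_rV R n)
  mu0 mu_ge0 mu_sigma_additive.

Let mu_sigma_finite : sigma_finite setT mu.
Proof.
rewrite /mu; have [m <-] := lebesgue_rV_sigma_finite_measure n.
exact: sigma_finiteT.
Qed.

HB.instance Definition _ := Measure_isSigmaFinite.Build _ _ _
  (@lebesgue_rV R n) mu_sigma_finite.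

End lebesgue_rV_measure.

Lemma lebesgue_rV_box (R : realType) (n : nat) (A : 'I_n -> set R) :
  (forall i, measurable (A i)) ->
  lebesgue_rV [set x : 'rV[R]_n | forall i, A i (x ord0 i)] =
  (\big[mule/1]_(i < n) lebesgue_measure (A i))%E.
Proof.
elim: n A => [|n IH] A mA.
  rewrite big_ord0 /= diracE mem_set //=; by case.
rewrite big_ord_recl -IH => [|i]; last exact: mA.
have mB : measurable
    [set x : 'rV[R]_n | forall i, A (lift ord0 i) (x ord0 i)].
  rewrite (_ : [set _ | _] = \bigcap_(i in [set: 'I_n])
      (fun x : 'rV[R]_n => x ord0 i) @^-1` A (lift ord0 i)); last first.
    by apply/seteqP; split=> x Hx i *; exact: Hx.
  apply: fin_bigcap_measurable => // i _.
  by rewrite -[_ @^-1` _]setTI; exact: measurable_rV_coord.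
transitivity ((lebesgue_measure \x lebesgue_rV)%E (A ord0 `*`
    [set x : 'rV[R]_n | forall i, A (lift ord0 i) (x ord0 i)])); last first.
  by rewrite product_measure1E //; exact: mA.
rewrite [LHS]/= /pushforward; apply: congr1.
apply/seteqP; split => -[a v] /= => [H|[Ha Hv] i].
  split=> [|i]; first by have := H ord0; rewrite rV_cons0.
  by have := H (lift ord0 i); rewrite rV_consS.
by have [j ->|->] := unliftP ord0 i; rewrite ?rV_cons0 ?rV_consS.
Qed.

Definition convex_body (R : realType) (d : nat) (K : set 'rV[R]_d) : Prop :=
  [/\ compact K, convex_set K & (0 < lebesgue_rV K)%E].

Definition centroid (R : realType) (d : nat) (A : set 'rV[R]_d) : 'rV[R]_d :=
  \row_i ((fine (lebesgue_rV A))^-1 *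
          \int[lebesgue_rV]_(x in A) (x ord0 i)).

Definition integer_lattice (R : realType) (d : nat) : set 'rV[R]_d :=
  [set x | x \is a mxOver Num.int].

(* 0 if A has no least element. *)
Definition minimum (R : realType) (A : set R) : R :=
  xget 0 [set m | A m /\ lbound A m].

Definition first_successive_minimum (R : realType) (d : nat)
    (K : set 'rV[R]_d) : R :=
  minimum [set l : R | 0 < l /\
    [set l *: x | x in K] `&` @integer_lattice R d <> [set 0]].

(* Main.v *)
Require Import Defs.
From HB Require Import structures.
From mathcomp Require Import all_boot all_order all_algebra.
From mathcomp Require Import finmap.
From mathcomp Require Import all_classical all_reals all_analysis.
From mathcomp Require Import measurable_realfun.
From mathcomp Require Import ring lra.

(** The bound is a packing argument for the symmetric core of [K].  Write
    [C = K /\ (- K)] and [lambda] for the first minimum.  For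
    [0 < t < lambda / 2] the translates [z + t C], with [z] a lattice point of
    [K], are pairwise disjoint: a common point of two of them would exhibit
    [z - w] as [t (c' - c)], an element of [2 t C], hence of [2 t K], and below
    the first minimum the only lattice point there is 0.  By convexity all these
    translates lie in [(1 + t) K].  Comparing volumes and letting [t] tend to
    [lambda / 2] ([lattice_packing], [exprn_le_left_limit]) gives
    [N (lambda / 2) ^ d vol C <= (1 + lambda / 2) ^ d vol K], where [N] is the
    number of lattice points of [K], so that everything reduces to the strict
    inequality of Milman and Pajor [vol K < 2 ^ d vol C] ([milman_pajor]), for
    which the position of the centroid is decisive.

    For that inequality let [F x] be the volume of [K /\ (x - K)], that is, the
    indicator of [K] convolved with itself.  It vanishes outside [2 K], its
    integral is [(vol K) ^ 2], its centroid is twice that of [K], namely 0, and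
    [F 0 = vol C].  By the Prekopa-Leindler inequality
    ([prekopa_leindler], proved by induction on the dimension from the
    Brunn-Minkowski inequality on the line) [F] is log-concave, so its logarithm
    has a supporting hyperplane at 0: there is [y] with
    [F x <= F 0 exp <y, x>] ([log_concave_support]).  Since
    [1 - u <= exp (- u)], this yields [F x (1 - <y, x>) <= F 0].  Integrating
    over [2 K], the linear term disappears because the centroid of [F] is 0, and
    there remains [(vol K) ^ 2 <= F 0 2 ^ d vol K].  The inequality is strict
    because [F] is close to 0 on a small homothetic copy of [K] near a point of
    [2 K] where a coordinate is maximal ([autocorrelation_small]).

    Both the supporting hyperplane and the fact that 0 is interior to [K] come
    from an elementary separation lemma for convex cones
    ([cone_separation]): if 0 were not interior, some nonzero linear functional
    would be nonnegative on [K]; its integral over [K] vanishes, so it would be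
    zero almost everywhere on [K], and [K] would be contained in a hyperplane up
    to a null set. *)

Set Implicit Arguments.
Unset Strict Implicit.
Unset Printing Implicit Defensive.

Import Order.TTheory GRing.Theory Num.Theory.
Import numFieldNormedType.Exports.

Local Open Scope classical_set_scope.
Local Open Scope ring_scope.

(** * Dot products *)

Section dot_product.
Variable R : realType.

Definition dot n (y x : 'rV[R]_n) : R := \sum_i y ord0 i * x ord0 i.

Lemma dotDl n (y z x : 'rV[R]_n) : dot (y + z) x = dot y x + dot z x.
Proof. by rewrite -big_split; apply: eq_bigr => i _; rewrite mxE mulrDl. Qed.

Lemma dotDr n (y x z : 'rV[R]_n) : dot y (x + z) = dot y x + dot y z.
Proof. by rewrite -big_split; apply: eq_bigr => i _; rewrite mxE mulrDr. Qed.

Lemma dotZr n (y x : 'rV[R]_n) (c : R) : dot y (c *: x) = c * dot y x.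
Proof. by rewrite mulr_sumr; apply: eq_bigr => i _; rewrite mxE mulrCA. Qed.

Lemma dotZl n (y x : 'rV[R]_n) (c : R) : dot (c *: y) x = c * dot y x.
Proof. by rewrite mulr_sumr; apply: eq_bigr => i _; rewrite mxE mulrA. Qed.

Definition axis n (i : 'I_n) : 'rV[R]_n := delta_mx ord0 i.

Lemma axisE n (i j : 'I_n) : axis i ord0 j = (j == i)%:R.
Proof. by rewrite mxE eqxx. Qed.

Lemma dot_axisr n (y : 'rV[R]_n) i : dot y (axis i) = y ord0 i.
Proof.
rewrite /dot (bigD1 i)//= axisE eqxx mulr1 big1 ?addr0// => j ji.
by rewrite axisE (negbTE ji) mulr0.
Qed.

Lemma dot_axisl n (x : 'rV[R]_n) i : dot (axis i) x = x ord0 i.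
Proof. by rewrite -dot_axisr; apply: eq_bigr => j _; rewrite mulrC. Qed.

Lemma axis_neq0 n (i : 'I_n) (c : R) : c != 0 -> c *: axis i != 0.
Proof.
move=> c0; apply: contra_neq c0 => /rowP/(_ i).
by rewrite !mxE !eqxx mulr1.
Qed.

End dot_product.
Arguments axis {R n}.

(** * Lebesgue integrals over row vectors *)

Section affine_change.
Variable R : realType.

(** Tonelli's theorem along the recursive definition of [lebesgue_rV]; the
    inductions on the dimension all go through this identity. *)
Lemma lebesgue_rV_integralS n (f : 'rV[R]_n.+1 -> \bar R) :
  measurable_fun [set: 'rV[R]_n.+1] f -> (forall x, 0 <= f x)%E ->
  (\int[lebesgue_rV]_x f x =
   \int[lebesgue_measure]_a \int[lebesgue_rV]_y f (rV_cons (a, y)))%E.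
Proof.
move=> mf f0.
pose mu : {sigma_finite_measure set 'rV[R]_n -> \bar R} := @lebesgue_rV R n.
have mc : measurable_fun [set: measurableTypeR R * 'rV[R]_n] (@rV_cons R n).
  exact: measurable_rV_cons.
have mfc : measurable_fun setT (f \o @rV_cons R n) by exact: measurableT_comp.
pose P : {measure set _ -> \bar R} := (lebesgue_measure \x mu)%E.
have := ge0_integral_pushforward mc P measurableT mf (fun x _ => f0 x).
have := fubini_tonelli1 (m1 := lebesgue_measure) (m2 := mu) _ mfc (fun x => f0 _).
rewrite preimage_setT => -> <-.
exact: eq_measure_integral.
Qed.

(** The image of Lebesgue measure under [x |-> c x + b] is [c^-1] times Lebesgue
    measure, since the two agree on half-open intervals. *)
Lemma integral_affine (f : R -> \bar R) (c b : R) : 0 < c ->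
  measurable_fun setT f -> (forall x, 0 <= f x)%E ->
  (\int[lebesgue_measure]_x f (c * x + b)%R =
   (c^-1)%:E * \int[lebesgue_measure]_x f x)%E.
Proof.
move=> c0 mf f0.
pose phi : R -> measurableTypeR R := fun x => c * x + b.
have mphi : measurable_fun [set: measurableTypeR R] phi.
  by apply: measurable_funD => //; exact: measurable_funM.
have ci0 : 0 <= c^-1 by rewrite invr_ge0 ltW.
have := ge0_integral_pushforward mphi (@lebesgue_measure R) measurableT mf
  (fun x _ => f0 x).
rewrite preimage_setT => <-.
transitivity (\int[mscale (NngNum ci0) (@lebesgue_measure R)]_x f x)%E; last first.
  by rewrite ge0_integral_mscale.
apply: eq_measure_integral => A mA _.
have cN0 : c != 0 by rewrite gt_eqF.
(* The canonical measure on a pushforward takes the proof of measurability as an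
   argument that unification cannot guess, hence the explicit structure. *)
pose mu : {measure set (measurableTypeR R) -> \bar R} :=
  measure_function_pushforward__canonical__measure_function_Measure
    lebesgue_measure mphi.
change (mu A = (c^-1)%:E * lebesgue_measure A)%E.
suff -> : (@lebesgue_measure R A = mscale (NngNum (ltW c0)) mu A)%E.
  by rewrite /mscale/= muleA -EFinM mulVf// mul1e.
apply: (lebesgue_measure_unique (mu := mscale (NngNum (ltW c0)) mu)) => // _ [[x y] _ <-].
  change (lebesgue_measure `]x, y]%classic =
    c%:E * lebesgue_measure (phi @^-1` `]x, y]%classic))%E.
  rewrite (_ : phi @^-1` _ = `](x - b) / c, (y - b) / c]%classic); last first.
    apply/seteqP; split => z /=; rewrite /phi !in_itv/= ltr_pdivrMr// ler_pdivlMr//;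
      by rewrite ltrBlDr lerBrDr mulrC.
  rewrite !lebesgue_measure_itv/= !lte_fin ltr_pM2r ?invr_gt0// ltrD2r.
  case: ifP => _; last by rewrite mule0.
  by rewrite -!EFinD -EFinM; congr EFin; field.
Qed.

Lemma measurable_rV_affine n (c : R) (b : 'rV[R]_n) :
  measurable_fun [set: 'rV[R]_n] (fun x => c *: x + b).
Proof.
apply: measurable_fun_rVP => i.
under eq_fun do rewrite !mxE.
apply: measurable_funD => //; apply: measurable_funM => //.
exact: measurable_rV_coord.
Qed.

Lemma integral_rV_affine n (f : 'rV[R]_n -> \bar R) (c : R) (b : 'rV[R]_n) :
  0 < c -> measurable_fun setT f -> (forall x, 0 <= f x)%E ->
  (\int[lebesgue_rV]_x f (c *: x + b)%R =
   (c^-1 ^+ n)%:E * \int[lebesgue_rV]_x f x)%E.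
Proof.
move=> c0.
elim: n => [|n IH] in f b * => mf f0.
  by rewrite expr0 mul1e; apply: eq_integral => x _; congr f; apply/rowP => -[].
have mc := @measurable_rV_cons R n.
pose b' : 'rV[R]_n := \row_j b ord0 (lift ord0 j).
have consE a y : c *: rV_cons (a, y) + b =
    rV_cons (c * a + b ord0 ord0, c *: y + b').
  apply/rowP => i; rewrite [LHS]mxE [X in X + _]mxE.
  have [j ->|->] := unliftP ord0 i; last by rewrite !rV_cons0.
  by rewrite !rV_consS !mxE.
rewrite lebesgue_rV_integralS//; last first.
  by apply: measurableT_comp => //; exact: measurable_rV_affine.
have mfc : measurable_fun setT (f \o @rV_cons R n) by exact: measurableT_comp.
pose G a := (\int[lebesgue_rV]_y f (rV_cons (a, y)))%E.
have mG : measurable_fun [set: R] G.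
  exact: (measurable_fun_fubini_tonelli_F (m2 := @lebesgue_rV R n) _ mfc (fun x => f0 _)).
have G0 a : (0 <= G a)%E by exact: integral_ge0.
transitivity (\int[lebesgue_measure]_a ((c^-1 ^+ n)%:E * G (c * a + b ord0 ord0)%R))%E.
  apply: eq_integral => a _.
  under eq_integral do rewrite consE.
  by rewrite (IH (fun y => f (rV_cons (c * a + b ord0 ord0, y))))//;
    apply: (measurableT_comp mfc); exact: measurable_pair1.
rewrite ge0_integralZl//; last 2 first.
- apply: (measurableT_comp mG); apply: measurable_funD => //; exact: measurable_funM.
- by rewrite lee_fin exprn_ge0// invr_ge0 ltW.
rewrite integral_affine// lebesgue_rV_integralS//.
by rewrite muleA -EFinM exprSr.
Qed.

Lemma affine_imageE n (A : set 'rV[R]_n) (c : R) (b : 'rV[R]_n) : c != 0 ->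
  [set c *: x + b | x in A] = (fun x => c^-1 *: x + - (c^-1 *: b)) @^-1` A.
Proof.
move=> cN0; apply/seteqP; split => [_ [x Ax <-]|x /= Ax].
  by rewrite /= scalerDr scalerA mulVf// scale1r addrK.
exists (c^-1 *: x + - (c^-1 *: b)) => //.
by rewrite scalerDr scalerN !scalerA mulfV// !scale1r subrK.
Qed.

Lemma measurable_affine_image n (A : set 'rV[R]_n) (c : R) (b : 'rV[R]_n) :
  0 < c -> measurable A -> measurable [set c *: x + b | x in A].
Proof.
move=> c0 mA; rewrite affine_imageE ?gt_eqF//.
by rewrite -[X in measurable X]setTI; exact: measurable_rV_affine.
Qed.

Lemma lebesgue_rV_affine n (A : set 'rV[R]_n) (c : R) (b : 'rV[R]_n) :
  0 < c -> measurable A ->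
  (lebesgue_rV [set (c *: x + b)%R | x in A] = (c ^+ n)%:E * lebesgue_rV A)%E.
Proof.
move=> c0 mA.
have := measurable_affine_image b c0 mA; rewrite affine_imageE ?gt_eqF// => mpre.
transitivity (\int[lebesgue_rV]_x
    (\1_((fun x : 'rV[R]_n => c^-1 *: x + - (c^-1 *: b)) @^-1` A) x)%:E)%E.
  by rewrite integral_indic// setIT.
rewrite (_ : (fun _ => _) = (fun x => (\1_A (c^-1 *: x + - (c^-1 *: b)))%:E)); last first.
  by apply/funext => x; rewrite indicE !indicE; congr ((_ : bool)%:R%:E).
rewrite (integral_rV_affine (f := fun x => (\1_A x)%:E)) ?invr_gt0//.
- by rewrite invrK integral_indic// setIT.
- exact/measurable_EFinP.
Qed.

End affine_change.

(** * Borel sets, cubes and hyperplanes *)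

Section closed_measurable.
Variable R : realType.

Definition cube n (r : R) : set 'rV[R]_n := [set x | forall i, `|x ord0 i| <= r].

Lemma measurable_rV_pi n (A : 'I_n -> set R) : (forall i, measurable (A i)) ->
  measurable [set x : 'rV[R]_n | forall i, A i (x ord0 i)].
Proof.
move=> mA.
rewrite (_ : [set _ | _] = \bigcap_(i in [set: 'I_n])
    (fun x : 'rV[R]_n => x ord0 i) @^-1` A i); last first.
  by apply/seteqP; split=> x Hx i *; exact: Hx.
apply: fin_bigcap_measurable => // i _.
by rewrite -[_ @^-1` _]setTI; exact: measurable_rV_coord.
Qed.

(** An open set is the union of the boxes with rational center and radius that
    it contains, and there are countably many of them. *)
Lemma open_rV_measurable n (U : set 'rV[R]_n) : open U -> measurable U.
Proof.
move=> oU.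
pose box (q : 'rV[rat]_n * rat) : set 'rV[R]_n :=
  [set x | forall i, x ord0 i \in `](ratr (q.1 ord0 i - q.2)), (ratr (q.1 ord0 i + q.2))[].
pose P (q : 'rV[rat]_n * rat) := box q `<=` U.
rewrite (_ : U = \bigcup_(q in [set: 'rV[rat]_n * rat]) (if `[< P q >] then box q else set0)).
  apply: countable_bigcupT_measurable => [|q]; first exact: countableP.
  case: ifP => // _.
  apply: (measurable_rV_pi (A := fun i =>
    `](ratr (q.1 ord0 i - q.2)), (ratr (q.1 ord0 i + q.2))[%classic)) => i.
  exact: measurable_itv.
apply/seteqP; split => [x Ux|x [q _]]; last by case: ifP => // /asboolP; apply.
have /nbhs_ballP[e /= e0 eU] : nbhs x U by move: oU; rewrite openE; exact.
(* A box of radius [d < e / 2] around a rational point at distance less than [d]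
   from [x] contains [x] and stays in the ball of radius [e]. *)
have [d /andP[d0 de]] : exists d : rat, (0 < d) && (ratr d < e / 2).
  have /rat_in_itvoo[d] : 0 < e / 2 by rewrite divr_gt0.
  by rewrite in_itv/= ltr0q => dP; exists d.
have /choice[q qP] : forall i, exists p : rat,
    x ord0 i - ratr d < ratr p < x ord0 i + ratr d.
  move=> i; have : x ord0 i - ratr d < x ord0 i + ratr d.
    by rewrite ltrD2l gtrN// ltr0q.
  by move=> /rat_in_itvoo[p]; rewrite in_itv/= => pP; exists p.
have boxx : box (\row_i q i, d) x.
  move=> i /=; rewrite mxE in_itv/= rmorphB rmorphD/=.
  by have /andP[? ?] := qP i; apply/andP; split; lra.
exists (\row_i q i, d) => //; rewrite ifT//; apply/asboolP => y yb.
apply: eU; split => // i j; rewrite (ord1 i).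
have := yb j; have := boxx j; rewrite /= mxE !in_itv/= rmorphB rmorphD/=.
move=> /andP[a1 a2] /andP[a3 a4]; rewrite /ball/= ltr_norml; apply/andP; split; lra.
Qed.

Lemma closed_rV_measurable n (A : set 'rV[R]_n) : closed A -> measurable A.
Proof.
move=> cA; rewrite -[A]setCK; apply: measurableC; apply: open_rV_measurable.
exact: closed_openC.
Qed.

Lemma compact_rV_measurable n (A : set 'rV[R]_n) : compact A -> measurable A.
Proof. by move/(compact_closed (@norm_hausdorff _ _)); exact: closed_rV_measurable. Qed.

Lemma coord_le_norm n (x : 'rV[R]_n) i : `|x ord0 i| <= `|x|.
Proof.
rewrite [leRHS]/Num.norm/= mx_normrE.
exact: (le_bigmax_cond _ (fun ij : 'I_1 * 'I_n => `|x ij.1 ij.2|) (j := (ord0, i))).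
Qed.

Lemma compact_rV_cube n (A : set 'rV[R]_n) : compact A ->
  exists2 r : R, 0 < r & A `<=` cube r.
Proof.
move=> /compact_bounded/pinfty_ex_gt0[r r0 Ar]; exists r => // x Ax i.
exact/(le_trans (coord_le_norm x i))/Ar.
Qed.

Lemma measurable_cube n (r : R) : measurable (@cube n r).
Proof.
apply: (measurable_rV_pi (A := fun=> [set t : R | `|t| <= r])) => i.
rewrite (_ : [set _ | _] = `[-r, r]%classic); first exact: measurable_itv.
by apply/seteqP; split => x /=; rewrite in_itv/= ler_norml.
Qed.

Lemma lebesgue_rV_cube n (r : R) : 0 <= r ->
  lebesgue_rV (@cube n r) = ((2 * r) ^+ n)%:E.
Proof.
move=> r0.
rewrite (_ : cube r = [set x : 'rV[R]_n | forall i, `[-r, r]%classic (x ord0 i)]).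
  rewrite (lebesgue_rV_box (A := fun=> `[- r, r]%classic)) => [|i]; last exact: measurable_itv.
  rewrite (eq_bigr (fun=> (2 * r)%:E)) => [|i _].
    rewrite prodEFin prodr_const card_ord; reflexivity.
  rewrite lebesgue_measure_itv/= lte_fin.
  case: ltP => rr; rewrite -?EFinD; first by congr EFin; lra.
  by congr EFin; lra.
by apply/seteqP; split => x xr i; have := xr i; rewrite /= in_itv/= ler_norml.
Qed.

Lemma measurable_rV_dot n (y : 'rV[R]_n) :
  measurable_fun [set: 'rV[R]_n] (dot y).
Proof.
apply: measurable_sum => i; apply: measurable_funM => //.
exact: measurable_rV_coord.
Qed.

(** Slicing along the first coordinate reduces the dimension, unless the
    normal vector is the first axis; the hyperplane is then a single slice. *)
Lemma hyperplane_null n (y : 'rV[R]_n) (c : R) : y != 0 ->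
  lebesgue_rV [set x : 'rV[R]_n | dot y x = c] = 0%E.
Proof.
have mH m (z : 'rV[R]_m) b :
    measurable [set x : 'rV[R]_m | dot z x = b].
  rewrite -[X in measurable X]setTI.
  exact: measurable_rV_dot (measurable_set1 b).
elim: n => [|n IH] in y c *.
  by move=> /eqP[]; apply/rowP => -[].
move=> y0; set H := [set _ | _].
have mI : measurable_fun [set: 'rV[R]_n.+1] (fun x => (\1_H x : R)%:E).
  by apply/measurable_EFinP; apply: measurable_indic; exact: mH.
transitivity (\int[lebesgue_rV]_x (\1_H x : R)%:E)%E.
  by rewrite integral_indic ?setIT//; exact: mH.
rewrite lebesgue_rV_integralS//.
pose y' : 'rV[R]_n := \row_j y ord0 (lift ord0 j).
have HE a v : H (rV_cons (a, v)) =
    (dot y' v = c - y ord0 ord0 * a).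
  rewrite /H/= /dot big_ord_recl rV_cons0/=.
  rewrite (eq_bigr (fun i => y' ord0 i * v ord0 i)); last first.
    by move=> i _; rewrite rV_consS mxE.
  by apply/propext; split => [<-|->]; [rewrite addrAC subrr add0r|rewrite addrC subrK].
have [y'0|y'0] := eqVneq y' 0; last first.
  rewrite integral0_eq// => a _.
  transitivity (lebesgue_rV [set v | dot y' v = c - y ord0 ord0 * a]).
    rewrite -[X in lebesgue_rV X]setIT -integral_indic//; last exact: mH.
    apply: eq_integral => v _; congr (_%:E); rewrite !indicE; congr ((_ : bool)%:R).
    by apply/idP/idP; rewrite !inE HE.
  exact: IH.
have y00 : y ord0 ord0 != 0.
  apply: contra_neq y0 => y00; apply/rowP => i; rewrite mxE.
  have [j ->|->//] := unliftP ord0 i.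
  by have /rowP/(_ j) := y'0; rewrite !mxE.
have := @lebesgue_measure_set1 R (c / y ord0 ord0) => s1.
rewrite (ae_eq_integral (cst 0%E))//=; first by rewrite integral0.
  apply: (measurable_fun_fubini_tonelli_F (m2 := @lebesgue_rV R n)
    ((fun x => (\1_H x)%:E) \o @rV_cons R n)) => [|x]; last by rewrite lee_fin.
  exact: measurableT_comp mI (@measurable_rV_cons R n).
exists [set c / y ord0 ord0]; split => // a /=.
apply: contra_notP => /= aN _; rewrite integral0_eq// => v _.
rewrite indicE memNset// HE y'0 /dot big1 => [|i _]; last by rewrite mxE mul0r.
move=> /esym/eqP; rewrite subr_eq0 => /eqP ca; apply: aN.
by rewrite ca mulrAC mulfV// mul1r.
Qed.

End closed_measurable.

(** * The Prekopa-Leindler inequality on the line *)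

Section one_dimensional.
Variable R : realType.
Implicit Types (A B C : set R) (t : R).
Local Notation mu := (@lebesgue_measure R).

Lemma lebesgue_affine A (c b : R) : 0 < c -> measurable A ->
  measurable [set c * x + b | x in A] /\
  (mu [set (c * x + b)%R | x in A] = c%:E * mu A)%E.
Proof.
move=> c0 mA.
have cN0 : c != 0 by rewrite gt_eqF.
have imE : [set c * x + b | x in A] = (fun x => c^-1 * x + - (c^-1 * b)) @^-1` A.
  apply/seteqP; split => [_ [x Ax <-]|x /= Ax].
    by rewrite /= (_ : _ + _ = x)//; field.
  by exists (c^-1 * x + - (c^-1 * b)) => //; field.
have mpre : measurable ((fun x => c^-1 * x + - (c^-1 * b)) @^-1` A).
  rewrite -[X in measurable X]setTI.
  apply: (_ : measurable_fun [set: R] (fun x => c^-1 * x + - (c^-1 * b))) => //.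
  by apply: measurable_funD => //; exact: measurable_funM.
rewrite imE; split => //.
transitivity (\int[mu]_x
    (\1_((fun x : R => c^-1 * x + - (c^-1 * b)) @^-1` A) x)%:E)%E.
  by rewrite integral_indic// setIT.
rewrite (_ : (fun _ => _) = (fun x => (\1_A (c^-1 * x + - (c^-1 * b)))%:E)); last first.
  by apply/funext => x; rewrite indicE !indicE; congr ((_ : bool)%:R%:E).
rewrite (integral_affine (f := fun x => (\1_A x)%:E)) ?invr_gt0//.
- by rewrite invrK integral_indic// setIT.
- exact/measurable_EFinP.
Qed.

(** If [a] were the greatest element of [A] and [b] the least one of [B], then
    [(1 - t) A + t b] and [(1 - t) a + t B] would be copies of the scaled sets
    lying on the two sides of [(1 - t) a + t b], both inside [C], and their
    measures would add up.  For arbitrary bounded sets, [a] and [b] are chosen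
    within [e] of the supremum and of the infimum, at the cost of at most [e] in
    the measure of each set. *)
Lemma brunn_minkowski1 A B C t r : 0 < t < 1 ->
  measurable A -> measurable B -> measurable C ->
  A `<=` `[- r, r] -> B `<=` `[- r, r] -> A !=set0 -> B !=set0 ->
  (forall a b, A a -> B b -> C ((1 - t) * a + t * b)) ->
  ((1 - t)%:E * mu A + t%:E * mu B <= mu C)%E.
Proof.
move=> /andP[t0 t1] mA mB mC Ar Br A0 B0 ABC.
have t1' : 0 < 1 - t by rewrite subr_gt0.
have hsA : has_sup A.
  by split => //; exists r => x /Ar /=; rewrite in_itv/= => /andP[].
have hiB : has_inf B.
  by split => //; exists (- r) => x /Br /=; rewrite in_itv/= => /andP[].
apply/lee_addgt0Pr => e e0.
have [a Aa ae] := sup_adherent e0 hsA.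
have [b Bb be] := inf_adherent e0 hiB.
(* The half-line cutting [A] is open and the one cutting [B] is closed, which
   makes the two translates disjoint. *)
pose A' := A `&` `]-oo, a[; pose B' := B `&` `[b, +oo[.
have mA' : measurable A' by apply: measurableI => //; exact: measurable_itv.
have mB' : measurable B' by apply: measurableI => //; exact: measurable_itv.
have [mI1 I1] := lebesgue_affine (t * b) t1' mA'.
have [mI2 I2] := lebesgue_affine ((1 - t) * a) t0 mB'.
have A'le : (mu A <= mu A' + e%:E)%E.
  rewrite (_ : A = A' `|` (A `&` `[a, +oo[)); last first.
    by rewrite -setIUr -[LHS]setIT; congr (_ `&` _); apply/esym/seteqP;
       split => x //= _; rewrite !in_itv/= andbT; case: (ltP x a); [left|right].
  have mA2 : measurable (A `&` `[a, +oo[).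
    by apply: measurableI => //; exact: measurable_itv.
  apply: (@le_trans _ _ (mu A' + mu (A `&` `[a, +oo[))%E); first exact: measureU2.
  apply: leeD2l.
  apply: (@le_trans _ _ (mu `[a, a + e])); last first.
    rewrite lebesgue_measure_itv/= lte_fin; case: ifP => _; last by rewrite lee_fin ltW.
    by rewrite -EFinD lee_fin; lra.
  apply: le_measure; rewrite ?inE//.
  move=> x [Ax] /=; rewrite !in_itv/= andbT => ax; rewrite ax/=.
  by have := sup_upper_bound hsA Ax; lra.
have B'le : (mu B <= mu B' + e%:E)%E.
  rewrite (_ : B = B' `|` (B `&` `]-oo, b[)); last first.
    by rewrite -setIUr -[LHS]setIT; congr (_ `&` _); apply/esym/seteqP;
       split => x //= _; rewrite !in_itv/= andbT; case: (ltP x b); [right|left].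
  have mB2 : measurable (B `&` `]-oo, b[).
    by apply: measurableI => //; exact: measurable_itv.
  apply: (@le_trans _ _ (mu B' + mu (B `&` `]-oo, b[))%E); first exact: measureU2.
  apply: leeD2l.
  apply: (@le_trans _ _ (mu `[b - e, b])); last first.
    rewrite lebesgue_measure_itv/= lte_fin; case: ifP => _; last by rewrite lee_fin ltW.
    by rewrite -EFinD lee_fin; lra.
  apply: le_measure; rewrite ?inE//.
  move=> x [Bx] /=; rewrite !in_itv/= => xb; rewrite (ltW xb) andbT.
  by have := ge_inf hiB.2 Bx; lra.
have UC : ((1 - t)%:E * mu A' + t%:E * mu B' <= mu C)%E.
  rewrite -I1 -I2 -measureU//.
    apply: le_measure; rewrite ?inE//; first exact: measurableU.
    move=> _ [[x [Ax _] <-]|[y [By _] <-]]; first exact: ABC.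
    by rewrite addrC; exact: ABC.
  rewrite -subset0 => _ [[x [_ /= xa] <-] [y [_ /= yb]]].
  move: xa yb; rewrite !in_itv/= andbT => xa yb E.
  have : t * b <= t * y by rewrite ler_pM2l.
  have : (1 - t) * x < (1 - t) * a by rewrite ltr_pM2l.
  by move: E; lra.
have -> : (e%:E = (1 - t)%:E * e%:E + t%:E * e%:E)%E.
  by rewrite -!EFinM -EFinD; congr EFin; ring.
apply: (@le_trans _ _ ((1 - t)%:E * (mu A' + e%:E) + t%:E * (mu B' + e%:E)))%E.
  by apply: leeD; apply: lee_wpmul2l => //; rewrite lee_fin ltW.
rewrite !muleDr//; do ?[by rewrite ge0_adde_def// ?inE// lee_fin ltW].
by rewrite addeACA; exact: leeD2r.
Qed.

End one_dimensional.

Lemma measurable_setb d (T : measurableType d) (k : T -> bool) :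
  measurable_fun setT k -> measurable [set x | k x].
Proof. by move=> mk; rewrite -[X in measurable X]setTI; exact: mk. Qed.

Section prekopa_leindler1.
Variable R : realType.
Local Notation mu := (@lebesgue_measure R).

(** Tonelli's theorem for the indicator of the region between the axis and the
    graph of [f]. *)
Lemma layer_cake (f : R -> R) : measurable_fun setT f -> (forall x, 0 <= f x) ->
  (\int[mu]_x (f x)%:E =
   \int[mu]_s ((\1_(`[0, +oo[ : set R) s)%:E * mu [set x | (s < f x)%R]))%E.
Proof.
move=> mf f0.
pose u (z : R * R) : R := (0 <= z.2)%R%:R * (z.2 < f z.1)%R%:R.
have mnat (g : R * R -> bool) : measurable_fun setT g ->
    measurable_fun setT (fun z => (g z)%:R : R).
  move=> mg; apply: (measurableT_comp (f := fun b : bool => b%:R : R)) => //.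
have mu_ : measurable_fun setT (fun z => (u z)%:E).
  apply/measurable_EFinP; apply: measurable_funM; apply: mnat.
    apply: measurable_fun_ler => //; exact: measurable_snd.
  apply: measurable_fun_ltr; first exact: measurable_snd.
  exact: (measurableT_comp mf measurable_fst).
have u0 z : (0 <= (u z)%:E)%E by rewrite lee_fin mulr_ge0.
have := fubini_tonelli (m1 := mu) (m2 := mu) (fun z => (u z)%:E) mu_ u0.
clear mu_ u0 mnat => E.
transitivity (\int[mu]_x \int[mu]_y (u (x, y))%:E)%E; last first.
  rewrite {}E; apply: eq_integral => s _; rewrite indicE /u/=.
  have ms : measurable [set x | s < f x].
    by apply: measurable_setb; exact: measurable_fun_ltr.
  rewrite mem_setE in_itv/= andbT; case: (0 <= s); last first.
    by rewrite mul0e integral0_eq// => x _; rewrite mul0r.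
  rewrite mul1e -[X in mu X]setIT -integral_indic//.
  by apply: eq_integral => x _; rewrite mul1r indicE mem_setE.
apply: eq_integral => x _; clear E.
transitivity (\int[mu]_s (\1_(`[0, f x[ : set R) s)%:E)%E.
  rewrite integral_indic// setIT; transitivity (mu `[0, f x[%classic) => //.
  rewrite lebesgue_measure_itv/= lte_fin -EFinB subr0.
  by case: ltP => // fx; congr EFin; apply/eqP; rewrite eq_le fx f0.
apply: eq_integral => s _; rewrite indicE mem_setE in_itv/= /u/=.
by rewrite -natrM mulnb.
Qed.

(** With both suprema equal to 1, every superlevel set of [f] or [g] below
    height 1 is nonempty, so the additive Brunn-Minkowski inequality applies at
    every height and can be integrated. *)
Lemma prekopa_leindler1_normalized (f g h : R -> R) (t r : R) : 0 < t < 1 ->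
  measurable_fun setT f -> measurable_fun setT g -> measurable_fun setT h ->
  (forall x, 0 <= f x <= 1) -> (forall x, 0 <= g x <= 1) -> (forall x, 0 <= h x) ->
  (forall x, r < `|x| -> f x = 0) -> (forall x, r < `|x| -> g x = 0) ->
  (forall s, s < 1 -> exists x, s < f x) -> (forall s, s < 1 -> exists x, s < g x) ->
  (forall x y, f x `^ (1 - t) * g y `^ t <= h ((1 - t) * x + t * y)) ->
  ((1 - t)%:E * (\int[mu]_x (f x)%:E) + t%:E * (\int[mu]_x (g x)%:E)
    <= \int[mu]_x (h x)%:E)%E.
Proof.
move=> /[dup] t01 /andP[t0 t1] mf mg mh f01 g01 h0 fr gr sf sg fgh.
have t1' : 0 < 1 - t by rewrite subr_gt0.
have f0 x : 0 <= f x by have /andP[] := f01 x.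
have g0 x : 0 <= g x by have /andP[] := g01 x.
have ml (k : R -> R) : measurable_fun setT k -> forall s, measurable [set x | s < k x].
  by move=> mk s; apply: measurable_setb; exact: measurable_fun_ltr.
pose L (k : R -> R) s := ((\1_(`[0, +oo[ : set R) s)%:E * mu [set x | (s < k x)%R])%E.
have mL (k : R -> R) : measurable_fun setT k -> measurable_fun setT (L k).
  move=> mk; apply: emeasurable_funM.
    by apply/measurable_EFinP; apply: measurable_indic; exact: measurable_itv.
  pose D := [set z : R * R | z.1 < k z.2].
  have mD : measurable D.
    apply: measurable_setb; apply: measurable_fun_ltr => //.
    exact: (measurableT_comp mk measurable_snd).
  have := measurable_fun_xsection mu mD.
  by congr measurable_fun; apply/funext => s /=; rewrite xsectionE.
have L0 k s : (0 <= L k s)%E by rewrite mule_ge0// lee_fin.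
have tE0 : (0 <= t%:E)%E by rewrite lee_fin ltW.
have tE1 : (0 <= (1 - t)%:E)%E by rewrite lee_fin ltW.
rewrite !layer_cake// -/(L f) -/(L g) -/(L h).
rewrite -!ge0_integralZl//; do ?[exact: mL|by rewrite lee_fin ltW|by move=> s _; exact: L0].
rewrite -ge0_integralD//; last 4 first.
- by move=> s _; exact: mule_ge0 tE1 (L0 f s).
- by apply: measurable_funeM; exact: mL.
- by move=> s _; exact: mule_ge0 tE0 (L0 g s).
- by apply: measurable_funeM; exact: mL.
apply: ge0_le_integral => //.
- by move=> s _; exact: adde_ge0 (mule_ge0 tE1 (L0 f s)) (mule_ge0 tE0 (L0 g s)).
- by apply: emeasurable_funD; apply: measurable_funeM; exact: mL.
- exact: mL.
move=> s _; rewrite /L indicE mem_setE in_itv/= andbT.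
case: (leP 0 s) => s0; last by rewrite !mul0e !mule0 adde0.
rewrite !mul1e; have [s1|s1] := leP 1 s.
  have e (k : R -> R) : (forall x, 0 <= k x <= 1) -> [set x | s < k x] = set0.
    move=> k01; rewrite -subset0 => x /=; have /andP[_] := k01 x; lra.
  by rewrite (e f)// (e g)// measure0 !mule0 adde0.
have sub (k : R -> R) : (forall x, r < `|x| -> k x = 0) -> [set x | s < k x] `<=` `[- r, r].
  move=> kr x /= sk; rewrite in_itv/= -ler_norml leNgt; apply/negP => /kr k0.
  by move: sk; rewrite k0 ltNge s0.
apply: (brunn_minkowski1 t01); do ?[exact: ml|exact: sub|exact: sf|exact: sg].
move=> x y /= sx sy; apply: lt_le_trans (fgh x y).
have -> : s = s `^ (1 - t) * s `^ t.
  by rewrite -powRD ?subrK ?powRr1//; apply/implyP => /eqP; lra.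
by apply: ltr_pM; rewrite ?powR_ge0//; apply: gt0_ltr_powR; rewrite ?nnegrE.
Qed.

(** Young's inequality for the conjugate exponents [(1 - t)^-1] and [t^-1]. *)
Lemma geometric_le_arithmetic (a b t : R) : 0 < t < 1 -> 0 <= a -> 0 <= b ->
  a `^ (1 - t) * b `^ t <= (1 - t) * a + t * b.
Proof.
move=> /andP[t0 t1] a0 b0; have t1' : 0 < 1 - t by rewrite subr_gt0.
have := @conjugate_powR R (a `^ (1 - t)) (b `^ t) (1 - t)^-1 t^-1
  (powR_ge0 _ _) (powR_ge0 _ _).
rewrite !invr_gt0 !invrK -!powRrM !mulfV ?gt_eqF// !powRr1// subrK.
by move=> /(_ t1' t0 erefl); rewrite [a * _]mulrC [b * _]mulrC.
Qed.

(** Dividing by the suprema reduces to functions of supremum 1.  The normalized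
    inequality has an arithmetic mean on its left-hand side, which dominates the
    geometric mean, and the latter reabsorbs the normalizing factors.  If a
    supremum is 0, then the left-hand side is 0. *)
Lemma prekopa_leindler1 (f g h : R -> R) (t r M : R) : 0 < t < 1 ->
  measurable_fun setT f -> measurable_fun setT g -> measurable_fun setT h ->
  (forall x, 0 <= f x <= M) -> (forall x, 0 <= g x <= M) -> (forall x, 0 <= h x <= M) ->
  (forall x, r < `|x| -> f x = 0) -> (forall x, r < `|x| -> g x = 0) ->
  (forall x, r < `|x| -> h x = 0) ->
  (forall x y, f x `^ (1 - t) * g y `^ t <= h ((1 - t) * x + t * y)) ->
  fine (\int[mu]_x (f x)%:E)%E `^ (1 - t) * fine (\int[mu]_x (g x)%:E)%E `^ t <=
  fine (\int[mu]_x (h x)%:E)%E.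
Proof.
move=> /[dup] t01 /andP[t0 t1] mf mg mh f0M g0M h0M fr gr hr fgh.
have t1' : 0 < 1 - t by rewrite subr_gt0.
have nn (k : R -> R) x : (forall x, 0 <= k x <= M) -> 0 <= k x.
  by move=> /(_ x)/andP[].
have fin (k : R -> R) : measurable_fun setT k -> (forall x, 0 <= k x <= M) ->
    (forall x, r < `|x| -> k x = 0) -> (\int[mu]_x (k x)%:E)%E \is a fin_num.
  move=> mk k0M kr; rewrite ge0_fin_numE; last first.
    by apply: integral_ge0 => x _; rewrite lee_fin nn.
  apply: (@le_lt_trans _ _ (\int[mu]_x (M%:E * (\1_(`[(- r)%R, r] : set R) x)%:E))%E).
    apply: ge0_le_integral => //.
    - by move=> x _; rewrite lee_fin nn.
    - exact/measurable_EFinP.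
    - apply: measurable_funeM; apply/measurable_EFinP.
      by apply: measurable_indic; exact: measurable_itv.
    move=> x _; rewrite -EFinM lee_fin indicE mem_setE in_itv/= -ler_norml.
    have [xr|/kr->] := leP `|x| r; last by rewrite mulr0.
    by rewrite mulr1; have /andP[] := k0M x.
  have M0 : 0 <= M by have /andP[] := k0M 0; exact: le_trans.
  rewrite ge0_integralZl//; last first.
    by apply/measurable_EFinP; apply: measurable_indic; exact: measurable_itv.
  have -> : (\int[mu]_x (\1_(`[(- r)%R, r] : set R) x)%:E = mu `[(- r)%R, r]%classic)%E.
    by rewrite integral_indic// setIT.
  rewrite lebesgue_measure_itv/= lte_fin.
  by case: ifP => _; rewrite ?mule0 ?ltry// -EFinD -EFinM ltry.
have sup0 (k : R -> R) : (forall x, 0 <= k x <= M) ->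
    [/\ has_sup (range k), forall x, k x <= sup (range k) & 0 <= sup (range k)].
  move=> k0M; have hk : has_sup (range k).
    split; first by exists (k 0); exists 0.
    by exists M => _ [x _ <-]; have /andP[] := k0M x.
  have ks x : k x <= sup (range k) by apply: sup_upper_bound => //; exists x.
  by split => //; apply: le_trans (ks 0); exact: nn.
have null (k : R -> R) : (forall x, 0 <= k x <= M) -> sup (range k) = 0 ->
    (\int[mu]_x (k x)%:E)%E = 0%E.
  move=> k0M s0; rewrite integral0_eq// => x _; congr EFin; apply/eqP.
  by rewrite eq_le nn// andbT -s0; have [] := sup0 _ k0M.
have [hsf fle sf0] := sup0 _ f0M; have [hsg gle sg0] := sup0 _ g0M.
set mf_ := sup (range f) in fle sf0 *; set mg_ := sup (range g) in gle sg0 *.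
have h0 : 0 <= fine (\int[mu]_x (h x)%:E)%E.
  by apply/fine_ge0/integral_ge0 => x _; rewrite lee_fin nn.
have [f_0|f_0] := eqVneq mf_ 0.
  by rewrite null// powR0 ?mul0r// gt_eqF.
have [g_0|g_0] := eqVneq mg_ 0.
  by rewrite [X in _ * fine X `^ _]null// [X in _ * X]powR0 ?mulr0// gt_eqF.
have f_gt0 : 0 < mf_ by rewrite lt_neqAle eq_sym f_0.
have g_gt0 : 0 < mg_ by rewrite lt_neqAle eq_sym g_0.
pose m := mf_ `^ (1 - t) * mg_ `^ t.
have m0 : 0 < m by rewrite mulr_gt0// powR_gt0.
have scaleE (k : R -> R) c : 0 < c -> measurable_fun setT k -> (forall x, 0 <= k x <= M) ->
    (forall x, r < `|x| -> k x = 0) ->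
    (\int[mu]_x (c^-1 * k x)%:E = (c^-1 * fine (\int[mu]_x (k x)%:E))%:E)%E.
  move=> c0 mk k0M kr; under eq_integral do rewrite EFinM.
  rewrite ge0_integralZl//; last 3 first.
  - exact/measurable_EFinP.
  - by move=> x _; rewrite lee_fin nn.
  - by rewrite lee_fin invr_ge0 ltW.
  by rewrite EFinM fineK// fin.
have near1 (k : R -> R) : has_sup (range k) -> 0 < sup (range k) -> forall s, s < 1 ->
    exists x, s < (sup (range k))^-1 * k x.
  move=> hk k0 s s1.
  have /sup_adherent/(_ hk)[_ [x _ <-] xs] : 0 < (1 - s) * sup (range k).
    by rewrite mulr_gt0// subr_gt0.
  by exists x; rewrite mulrC ltr_pdivlMr//; move: xs; lra.
have mscale_ (k : R -> R) c : measurable_fun setT k ->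
    measurable_fun setT (fun x => c * k x) by move=> mk; exact: measurable_funM.
have le1 (k : R -> R) : (forall x, 0 <= k x <= M) -> 0 < sup (range k) ->
    forall x, 0 <= (sup (range k))^-1 * k x <= 1.
  move=> k0M k0 x; apply/andP; split.
    by apply: mulr_ge0; [rewrite invr_ge0 ltW|exact: nn].
  by rewrite mulrC ler_pdivrMr// mul1r; have [_ /(_ x)] := sup0 _ k0M.
have supp (k : R -> R) c : (forall x, r < `|x| -> k x = 0) ->
    forall x, r < `|x| -> c * k x = 0 by move=> kr x /kr ->; rewrite mulr0.
have mh_ge0 x : 0 <= m^-1 * h x by apply: mulr_ge0; [rewrite invr_ge0 ltW|exact: nn].
have scaled_hyp x y : (mf_^-1 * f x) `^ (1 - t) * (mg_^-1 * g y) `^ t <=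
    m^-1 * h ((1 - t) * x + t * y).
  rewrite !powRM ?invr_ge0//; do ?[exact: nn]; rewrite mulrACA.
  have -> : mf_^-1 `^ (1 - t) * mg_^-1 `^ t = m^-1.
    have V (c s : R) : 0 < c -> c^-1 `^ s = (c `^ s)^-1.
      by move=> c0; rewrite -(powR_inv1 (ltW c0)) -powRrM mulN1r powRN.
    by rewrite !V// -invfM.
  by rewrite ler_pM2l ?invr_gt0.
have H := prekopa_leindler1_normalized t01 (mscale_ _ _ mf) (mscale_ _ _ mg)
  (mscale_ _ m^-1 mh) (le1 _ f0M f_gt0) (le1 _ g0M g_gt0) mh_ge0 (supp _ _ fr)
  (supp _ _ gr) (near1 _ hsf f_gt0) (near1 _ hsg g_gt0) scaled_hyp.
rewrite !scaleE// -!EFinM -EFinD lee_fin in H.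
set a := fine _ in H *; set b := fine (\int[mu]_x (g x)%:E)%E in H *.
have a0 : 0 <= a by apply/fine_ge0/integral_ge0 => x _; rewrite lee_fin nn.
have b0 : 0 <= b by apply/fine_ge0/integral_ge0 => x _; rewrite lee_fin nn.
have := le_trans (geometric_le_arithmetic t01 (mulr_ge0 _ a0) (mulr_ge0 _ b0)) H.
rewrite !invr_ge0 => /(_ sf0 sg0).
rewrite ler_pdivlMl// !powRM ?invr_ge0// => {}H; apply: le_trans H.
have cK (c s : R) : 0 < c -> c `^ s * c^-1 `^ s = 1.
  by move=> c0; rewrite -powRM ?invr_ge0 ?ltW// mulfV ?gt_eqF// powR1.
rewrite /m le_eqVlt; apply/orP; left; apply/eqP.
transitivity ((mf_ `^ (1 - t) * mf_^-1 `^ (1 - t)) * (mg_ `^ t * mg_^-1 `^ t) *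
  (a `^ (1 - t) * b `^ t)); last by ring.
by rewrite !cK// !mul1r.
Qed.

End prekopa_leindler1.

(** * The Prekopa-Leindler inequality in higher dimension *)

Section prekopa_leindler.
Variable R : realType.

(** Bounded functions supported in a cube form a class closed under slicing and
    partial integration, in which all integrals are finite: powers can then be
    taken of real numbers instead of extended ones. *)
Definition bounded_support n (M r : R) (f : 'rV[R]_n -> R) :=
  [/\ measurable_fun [set: 'rV[R]_n] f, forall x, 0 <= f x <= M
    & forall x, ~ cube r x -> f x = 0].

Lemma bounded_support_integral n (M r : R) (f : 'rV[R]_n -> R) : 0 <= r ->
  bounded_support M r f ->
  (0 <= \int[lebesgue_rV]_x (f x)%:E <= (M * (2 * r) ^+ n)%:E)%E.
Proof.
move=> r0 [mf f0M fr].
have f0 x : 0 <= f x by have /andP[] := f0M x.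
have M0 : 0 <= M by have /andP[] := f0M 0; exact: le_trans.
apply/andP; split; first by apply: integral_ge0 => x _; rewrite lee_fin.
have mc : measurable (@cube R n r) by exact: measurable_cube.
apply: (@le_trans _ _ (\int[lebesgue_rV]_x (M%:E * (\1_(@cube R n r) x)%:E))%E).
  apply: ge0_le_integral => //.
  - by move=> x _; rewrite lee_fin.
  - exact/measurable_EFinP.
  - by apply: measurable_funeM; apply/measurable_EFinP; exact: measurable_indic.
  move=> x _; rewrite -EFinM lee_fin indicE.
  have [xr|/fr->] := pselect (cube r x); last by rewrite mulr_ge0.
  by rewrite mem_set// mulr1; have /andP[] := f0M x.
rewrite ge0_integralZl//; last by apply/measurable_EFinP; exact: measurable_indic.
rewrite integral_indic// setIT.
by rewrite [X in (_ * X <= _)%E](_ : _ = ((2 * r) ^+ n)%:E)//; exact: lebesgue_rV_cube.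
Qed.

Lemma cube_cons n (r a : R) (v : 'rV[R]_n) :
  cube r (rV_cons (a, v)) <-> `|a| <= r /\ cube r v.
Proof.
split=> [ar|[ar vr] i]; last first.
  by have [j ->|->] := unliftP ord0 i; rewrite ?rV_consS ?rV_cons0.
split; first by have := ar ord0; rewrite rV_cons0.
by move=> i; have := ar (lift ord0 i); rewrite rV_consS.
Qed.

Definition slice_integral n (f : 'rV[R]_n.+1 -> R) (a : R) : R :=
  fine (\int[lebesgue_rV]_v (f (rV_cons (a, v)))%:E)%E.

Lemma slice_bounded_support n (M r : R) (f : 'rV[R]_n.+1 -> R) (a : R) :
  bounded_support M r f -> bounded_support M r (fun v => f (rV_cons (a, v))).
Proof.
move=> [mf f0M fr]; split => // [|v vr]; last by apply: fr => /cube_cons[].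
have : measurable_fun setT (f \o @rV_cons R n).
  exact: measurableT_comp mf (@measurable_rV_cons R n).
by move/measurableT_comp; apply; exact: measurable_pair1.
Qed.

Lemma slice_integral_bounded n (M r : R) (f : 'rV[R]_n.+1 -> R) : 0 <= r ->
  bounded_support M r f ->
  [/\ measurable_fun setT (slice_integral f),
      forall a, 0 <= slice_integral f a <= M * (2 * r) ^+ n,
      forall a, r < `|a| -> slice_integral f a = 0
    & (\int[lebesgue_rV]_x (f x)%:E =
       \int[lebesgue_measure]_a (slice_integral f a)%:E)%E].
Proof.
move=> r0 bf; have [mf f0M fr] := bf.
have f0 x : 0 <= f x by have /andP[] := f0M x.
have fin a : (\int[lebesgue_rV]_v (f (rV_cons (a, v)))%:E)%E \is a fin_num.
  have /andP[i0 iM] := bounded_support_integral r0 (slice_bounded_support a bf).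
  by rewrite ge0_fin_numE// (le_lt_trans iM)// ltry.
have mfE : measurable_fun [set: 'rV[R]_n.+1] (EFin \o f) by exact/measurable_EFinP.
split.
- apply: measurableT_comp => //.
  apply: (measurable_fun_fubini_tonelli_F (m2 := @lebesgue_rV R n)
    ((EFin \o f) \o @rV_cons R n)) => [|x]; last by rewrite lee_fin.
  exact: measurableT_comp mfE (@measurable_rV_cons R n).
- move=> a; have := bounded_support_integral r0 (slice_bounded_support a bf).
  by rewrite -[X in (0 <= X <= _)%E]fineK// !lee_fin.
- move=> a ra; rewrite /slice_integral integral0_eq// => v _.
  by rewrite fr// => /cube_cons[]; rewrite leNgt ra.
rewrite lebesgue_rV_integralS//.
by apply: eq_integral => a _; rewrite /slice_integral fineK.
Qed.

(** Induction on the dimension: integrating out all but the first coordinate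
    turns the hypothesis into the same hypothesis for functions of one real
    variable. *)
Theorem prekopa_leindler n (f g h : 'rV[R]_n -> R) (t M r : R) :
  0 < t < 1 -> 0 <= r ->
  bounded_support M r f -> bounded_support M r g -> bounded_support M r h ->
  (forall x y, f x `^ (1 - t) * g y `^ t <= h ((1 - t) *: x + t *: y)) ->
  fine (\int[lebesgue_rV]_x (f x)%:E)%E `^ (1 - t) *
  fine (\int[lebesgue_rV]_x (g x)%:E)%E `^ t <=
  fine (\int[lebesgue_rV]_x (h x)%:E)%E.
Proof.
move=> t01 r0; elim: n => [|n IH] in f g h M *.
  move=> bf bg bh fgh.
  have E (k : 'rV[R]_0 -> R) : measurable_fun [set: 'rV[R]_0] k ->
      (\int[lebesgue_rV]_x (k x)%:E = (k 0)%:E)%E.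
    move=> mk; rewrite (_ : (fun _ => _) = fun=> (k 0)%:E).
      rewrite integral_cst//.
      by rewrite /lebesgue_rV/= diracT mule1.
    by apply/funext => x; rewrite (_ : x = 0)//; apply/rowP => -[].
  have [mf _ _] := bf; have [mg _ _] := bg; have [mh _ _] := bh.
  by rewrite !E//=; have := fgh 0 0; rewrite !scaler0 addr0.
move=> bf bg bh fgh.
have [mF F0 Fr ->] := slice_integral_bounded r0 bf.
have [mG G0 Gr ->] := slice_integral_bounded r0 bg.
have [mH H0 Hr ->] := slice_integral_bounded r0 bh.
apply: (prekopa_leindler1 t01 mF mG mH F0 G0 H0 Fr Gr Hr) => a b.
apply: (IH _ _ _ M); do ?exact: slice_bounded_support.
move=> x y; apply: (le_trans (fgh _ _)).
rewrite le_eqVlt; apply/orP; left; apply/eqP; congr h.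
apply/rowP => i; rewrite [LHS]mxE [X in X + _]mxE [X in _ + X]mxE.
have [j ->|->] := unliftP ord0 i; last by rewrite !rV_cons0.
by rewrite !rV_consS !mxE.
Qed.

End prekopa_leindler.

(** * Separation of convex sets and supporting exponentials *)

Section separation.
Variable R : realType.

(** A Hahn-Banach argument by hand: the functional is built on the subspaces
    spanned by more and more coordinate axes.  When the next axis [k] is added,
    the constraints on the new coefficient coming from both sides of the
    hyperplane [x_k = 0] are compatible because positive combinations of
    opposite points fall back into the previous subspace.  If all the points lie
    on one side, the coordinate [k] itself is a suitable functional. *)
Lemma cone_separation n (P : set 'rV[R]_n) (i : 'I_n) (s : R) :
  (forall x y (a b : R), P x -> P y -> 0 < a -> 0 < b -> P (a *: x + b *: y)) ->
  s != 0 -> ~ P (s *: axis i) ->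
  exists2 y : 'rV[R]_n, y != 0 & forall x, P x -> 0 <= dot y x.
Proof.
move=> Pcone s0 Ps.
have PZ x (c : R) : P x -> 0 < c -> P (c *: x).
  move=> Px c0; have c2 : 0 < c / 2 by rewrite divr_gt0.
  have := Pcone _ _ _ _ Px Px c2 c2.
  by rewrite -scalerDl (_ : c / 2 + c / 2 = c)//; field.
pose W (l : seq 'I_n) (x : 'rV[R]_n) := forall j, j \notin i :: l -> x ord0 j = 0.
have claim l : exists y : 'rV[R]_n,
    [/\ y != 0, W l y & forall x, P x -> W l x -> 0 <= dot y x].
  elim: l => [|k l [y [y0 Wy Py]]].
    exists ((- s) *: axis i); split; first by rewrite axis_neq0// oppr_eq0.
      by move=> j; rewrite inE => /negbTE ji; rewrite mxE axisE ji mulr0.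
    move=> x Px Wx; rewrite dotZl dot_axisl mulNr oppr_ge0 leNgt; apply/negP => sx.
    have xi0 : x ord0 i != 0 by apply: contraTneq sx => ->; rewrite mulr0 ltxx.
    have xE : x = x ord0 i *: axis i.
      apply/rowP => j; rewrite mxE axisE; have [->|ji] := eqVneq j i.
        by rewrite mulr1.
      by rewrite mulr0; apply: Wx; rewrite inE.
    have := congr1 ( *:%R (s / x ord0 i)) xE; rewrite scalerA divfK// => E.
    apply: Ps; rewrite -E; apply: PZ => //.
    by rewrite -(pmulr_rgt0 _ (_ : 0 < x ord0 i ^+ 2)) ?exprn_even_gt0// mulrCA expr2 mulfK.
  have [ki|ki] := boolP (k \in i :: l).
    exists y; split => // [j jl|x Px Wx].
      by apply: Wy; apply: contra jl; rewrite !inE => /orP[->//|->]; rewrite !orbT.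
    apply: Py => // j jl; apply: Wx; apply: contra jl.
    by rewrite 2!inE => /or3P[/eqP->|/eqP->//|jl]; rewrite inE ?eqxx// jl orbT.
  have Wk j : j \notin [:: i, k & l] -> j \notin i :: l /\ j != k.
    by rewrite !inE !negb_or => /and3P[-> -> ->].
  have Wax (c : R) : W (k :: l) (c *: axis k).
    by move=> j /Wk[_ /negbTE jk]; rewrite mxE axisE jk mulr0.
  have restrict x : W (k :: l) x -> x ord0 k = 0 -> W l x.
    move=> Wx xk j jl; have [->//|jk] := eqVneq j k; apply: Wx.
    by move: jl; rewrite !inE !negb_or => /andP[-> ->]; rewrite jk.
  have [neg|neg] := pselect (exists x, [/\ P x, W (k :: l) x & x ord0 k < 0]);
    last first.
    exists (1 *: axis k); split; [by rewrite axis_neq0// oner_eq0|exact: Wax|].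
    move=> x Px Wx; rewrite dotZl dot_axisl mul1r leNgt; apply/negP => xk.
    by apply: neg; exists x.
  have [pos|pos] := pselect (exists x, [/\ P x, W (k :: l) x & 0 < x ord0 k]);
    last first.
    exists ((-1) *: axis k); split; [by rewrite axis_neq0// oppr_eq0 oner_eq0|exact: Wax|].
    move=> x Px Wx; rewrite dotZl dot_axisl mulN1r oppr_ge0 leNgt; apply/negP => xk.
    by apply: pos; exists x.
  pose L := [set - dot y x / x ord0 k | x in [set x | [/\ P x, W (k :: l) x & 0 < x ord0 k]]].
  have LU x' : P x' -> W (k :: l) x' -> x' ord0 k < 0 ->
      ubound L (- dot y x' / x' ord0 k).
    move=> Px' Wx' x'k _ [x [Px Wx xk] <-].
    have nx'k : 0 < - x' ord0 k by rewrite oppr_gt0.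
    have := Py _ (Pcone _ _ _ _ Px Px' nx'k xk) => /(_ _)/wrap[].
      apply: restrict => [j jl|]; first by rewrite !mxE (Wx _ jl) (Wx' _ jl) !mulr0 addr0.
      by rewrite !mxE; ring.
    rewrite dotDr !dotZr => H.
    rewrite -[leRHS]mulrNN -invrN opprK ler_pdivlMr// mulrAC ler_pdivrMr//.
    by move: H; lra.
  have hL : has_sup L.
    split; first by have [x [Px Wx xk]] := pos; exists (- dot y x / x ord0 k); exists x.
    by have [x [Px Wx xk]] := neg; exists (- dot y x / x ord0 k); exact: LU.
  have yk : y ord0 k = 0 by exact: Wy.
  exists (y + sup L *: axis k); split.
  - apply: contra_neq y0 => /rowP H; apply/rowP => j; have := H j.
    rewrite !mxE eqxx/=; have [->|_] := eqVneq j k; first by rewrite yk.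
    by rewrite mulr0 addr0.
  - by move=> j jl; have [jl' jk] := Wk _ jl; rewrite !mxE (Wy _ jl') (negbTE jk) andbF mulr0 addr0.
  - move=> x Px Wx; rewrite dotDl dotZl dot_axisl.
    have [xk|xk|xk] := ltgtP (x ord0 k) 0.
    + have := ge_sup hL.1 (LU _ Px Wx xk).
      rewrite ler_ndivlMr// => H; lra.
    + have : - dot y x / x ord0 k <= sup L by apply: sup_upper_bound => //; exists x.
      rewrite ler_pdivrMr// => H; lra.
    + by rewrite xk mulr0 addr0; apply: Py => //; exact: restrict.
have [y [y0 _ Py]] := claim (enum 'I_n).
by exists y => // x Px; apply: Py => // j; rewrite inE mem_enum orbT.
Qed.

(** The hypothesis says that a whole half-axis avoids [S], hence that one point
    of it avoids the convex cone generated by [S]. *)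
Lemma convex_separation n (S : set 'rV[R]_n) (i : 'I_n) (s : R) :
  (forall x y (t : R), S x -> S y -> 0 < t < 1 -> S ((1 - t) *: x + t *: y)) ->
  s != 0 -> (forall c : R, 0 < c -> ~ S (c *: (s *: axis i))) ->
  exists2 y : 'rV[R]_n, y != 0 & forall x, S x -> 0 <= dot y x.
Proof.
move=> Sconv s0 Si.
pose P := [set z | exists c x, [/\ (0 : R) < c, S x & z = c *: x]].
have [||y y0 Py] := @cone_separation n P i s _ s0.
- move=> _ _ a b [c [x [c0 Sx ->]]] [d [y [d0 Sy ->]]] a0 b0.
  have p : 0 < a * c by rewrite mulr_gt0.
  have q : 0 < b * d by rewrite mulr_gt0.
  exists (a * c + b * d), ((1 - b * d / (a * c + b * d)) *: x +
    (b * d / (a * c + b * d)) *: y).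
  have pq : a * c + b * d != 0 by rewrite gt_eqF// addr_gt0.
  split; first by rewrite addr_gt0.
    apply: Sconv => //; rewrite divr_gt0 ?addr_gt0//=.
    by rewrite ltr_pdivrMr ?addr_gt0// mul1r ltrDr.
  rewrite scalerDr !scalerA; congr (_ *: _ + _ *: _); by field.
- move=> [c [x [c0 Sx]]] E; apply: (Si c^-1); first by rewrite invr_gt0.
  by rewrite E scalerA mulVf ?gt_eqF// scale1r.
by exists y => // x Sx; apply: Py; exists 1, x; split; rewrite ?scale1r.
Qed.

(** The strict hypograph of [ln (F / F 0)], which is convex and misses the
    positive vertical half-axis, is separated from it; the separating hyperplane
    is not vertical because [F] is positive around the origin. *)
Lemma log_concave_support n (F : 'rV[R]_n -> R) (delta : R) :
  (forall x, 0 <= F x) -> 0 < F 0 ->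
  (forall x y (t : R), 0 < t < 1 ->
    F x `^ (1 - t) * F y `^ t <= F ((1 - t) *: x + t *: y)) ->
  0 < delta ->
  (forall i, 0 < F (delta *: axis i)) -> (forall i, 0 < F (- delta *: axis i)) ->
  exists y : 'rV[R]_n, forall x, F x <= F 0 * expR (dot y x).
Proof.
move=> F0 F00 Fconc d0 Fp Fm.
pose tl (z : 'rV[R]_n.+1) : 'rV[R]_n := \row_j z ord0 (lift ord0 j).
pose T := [set z : 'rV[R]_n.+1 | F 0 * expR (z ord0 ord0) < F (tl z)].
have Tconv x y (t : R) : T x -> T y -> 0 < t < 1 -> T ((1 - t) *: x + t *: y).
  rewrite /T /= => Tx Ty /[dup] t01 /andP[t0 t1].
  rewrite (_ : tl _ = (1 - t) *: tl x + t *: tl y); last first.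
    by apply/rowP => j; rewrite !mxE.
  apply: lt_le_trans (Fconc _ _ _ t01).
  have -> : F 0 * expR (((1 - t) *: x + t *: y) ord0 ord0) =
      (F 0 * expR (x ord0 ord0)) `^ (1 - t) * (F 0 * expR (y ord0 ord0)) `^ t.
    rewrite !powRM ?expR_ge0// mulrACA -powRD ?subrK; last first.
      by apply/implyP => /eqP; lra.
    rewrite powRr1//; congr (_ * _); rewrite !mxE.
    by rewrite /powR !gt_eqF ?expR_gt0// !expRK -expRD.
  by apply: ltr_pM; rewrite ?powR_ge0//; apply: gt0_ltr_powR;
    rewrite ?nnegrE ?mulr_ge0 ?expR_ge0 ?subr_gt0.
have tl_ax (c : R) : tl (c *: axis ord0) = 0.
  by apply/rowP => j; rewrite !mxE eqxx/= mulr0.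
(* Above the origin, the point of height [c > 0] is not in the hypograph because
   [F 0 < F 0 * expR c]. *)
have [||z z0 Tz] := @convex_separation _ T ord0 1 Tconv.
- exact: oner_neq0.
- move=> c c0; rewrite scale1r /T/= tl_ax mxE axisE eqxx mulr1.
  by apply/negP; rewrite -leNgt ler_peMr ?F0// -expR0 ler_expR ltW.
pose v : 'rV[R]_n := tl z.
have dotE x : dot z x = z ord0 ord0 * x ord0 ord0 + dot v (tl x).
  by rewrite /dot big_ord_recl; congr (_ + _); apply: eq_bigr => j _; rewrite !mxE.
pose mk (c : R) (x : 'rV[R]_n) : 'rV[R]_n.+1 := rV_cons (c, x).
have mk0 c x : mk c x ord0 ord0 = c by rewrite /mk rV_cons0.
have mkt c x : tl (mk c x) = x by apply/rowP => j; rewrite mxE rV_consS.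
have key x c : F 0 * expR c < F x -> 0 <= z ord0 ord0 * c + dot v x.
  by move=> Fx; have := Tz (mk c x); rewrite dotE mk0 mkt; apply; rewrite /T/= mk0 mkt.
have z00 : z ord0 ord0 <= 0.
  have : F 0 * expR (-1) < F 0 by rewrite gtr_pMr// expR_lt1 ltrN10.
  by move/key; rewrite /dot big1 => [|j _]; rewrite ?mxE ?mulr0// addr0 mulrN1 oppr_ge0.
have low x : 0 < F x -> exists c, F 0 * expR c < F x.
  move=> Fx; exists (ln (F x / F 0 / 2)).
  by rewrite lnK ?posrE ?divr_gt0// mulrA mulrCA mulfV ?gt_eqF// mulr1 gtr_pMr// invf_lt1// ltr1n.
have zn0 : z ord0 ord0 != 0.
  apply: contra_neq z0 => zE; apply/rowP => j; rewrite mxE.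
  have [k ->|->//] := unliftP ord0 j.
  have pos x : 0 < F x -> 0 <= dot v x.
    by move=> /low[c] /key; rewrite zE mul0r add0r.
  have := pos _ (Fp k); have := pos _ (Fm k).
  rewrite !dotZr dot_axisr mxE => h1 h2; apply/eqP; rewrite eq_le; apply/andP; split.
    by rewrite -(pmulr_rle0 _ d0); lra.
  by rewrite -(pmulr_rge0 _ d0); lra.
have zlt : z ord0 ord0 < 0 by rewrite lt_neqAle zn0.
exists ((- z ord0 ord0)^-1 *: v) => x; rewrite leNgt; apply/negP => Fx.
set u := dot _ x in Fx.
(* As [F x] exceeds [F 0 * expR u] strictly, there is still a point of the strict
   hypograph above height [u]; the logarithm of the midpoint provides one. *)
pose w := (F x / F 0 + expR u) / 2.
have Fw : expR u < F x / F 0 by rewrite ltr_pdivlMr// mulrC.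
have w0 : 0 < w by rewrite /w divr_gt0// addr_gt0 ?expR_gt0// (lt_trans _ Fw)// expR_gt0.
have /key : F 0 * expR (ln w) < F x.
  by rewrite lnK// mulrC -ltr_pdivlMr// /w; lra.
have uw : u < ln w by rewrite -ltr_expR lnK// /w; lra.
have uE : dot v x = - z ord0 ord0 * u.
  by rewrite /u dotZl mulrA mulfV ?mul1r// oppr_eq0.
rewrite uE mulNr subr_ge0 leNgt => /negP; apply.
by rewrite ltr_nM2l.
Qed.

End separation.

(** * Convex bodies with centroid at the origin *)

Section convex_sets.
Variables (R : realType) (d : nat) (K : set 'rV[R]_d).
Hypothesis Kconv : convex_set K.

Lemma convex_set_comb x y (t : R) : K x -> K y -> 0 <= t <= 1 ->
  K ((1 - t) *: x + t *: y).
Proof.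
move=> Kx Ky /andP[t0 t1].
have := Kconv (Itv01 t0 t1) (mem_set Ky) (mem_set Kx).
by rewrite inE addrC.
Qed.

Lemma convex_average n (p : 'I_n.+1 -> 'rV[R]_d) :
  (forall i, K (p i)) -> K (n.+1%:R^-1 *: \sum_i p i).
Proof.
elim: n => [|n IH] in p * => Kp.
  by rewrite big_ord_recl big_ord0 addr0 invr1 scale1r.
have n0 : (n.+1%:R : R) != 0 by rewrite pnatr_eq0.
have n1 : (n.+2%:R : R) != 0 by rewrite pnatr_eq0.
rewrite big_ord_recr /= (_ : _ *: _ = (1 - n.+2%:R^-1) *:
  (n.+1%:R^-1 *: \sum_(i < n.+1) p (widen_ord (leqnSn n.+1) i)) + n.+2%:R^-1 *: p ord_max).
  apply: convex_set_comb => //; first exact: IH.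
  by rewrite invr_ge0 ler0n/= invf_le1 ?ltr0n// ler1n.
rewrite scalerDr scalerA; congr (_ *: _ + _).
move: n0 n1; rewrite -[n.+2%:R]natr1; move: (n.+1%:R : R) => a a0 a1.
by field; rewrite a0.
Qed.

Lemma convex_symmetric_axis (c s : R) i : 0 < c -> K (c *: axis i) -> K (- c *: axis i) ->
  `|s| <= c -> K (s *: axis i).
Proof.
move=> c0 Kp Km; rewrite ler_norml => /andP[sm sp].
have cN0 : c != 0 by rewrite gt_eqF.
rewrite (_ : s *: _ = (1 - (1 + s / c) / 2) *: (- c *: axis i) +
  ((1 + s / c) / 2) *: (c *: axis i)); last first.
  by rewrite !scalerA -scalerDl; congr (_ *: _); field.
apply: convex_set_comb => //.
have : -1 <= s / c by rewrite ler_pdivlMr// mulN1r.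
have : s / c <= 1 by rewrite ler_pdivrMr// mul1r.
by move=> h1 h2; apply/andP; split; lra.
Qed.

End convex_sets.

Section centered_body.
Variables (R : realType) (d : nat) (K : set 'rV[R]_d).
Hypotheses (hK : convex_body K) (hc : centroid K = 0).

Let V : R := fine (lebesgue_rV K).

Lemma body_measurable : measurable K.
Proof. by have [cK _ _] := hK; exact: compact_rV_measurable. Qed.
Let mK := body_measurable.

Lemma body_volume_fin : lebesgue_rV K = V%:E.
Proof.
have [cK _ V0] := hK; have [r r0 Kr] := compact_rV_cube cK.
rewrite /V fineK// ge0_fin_numE; last exact: ltW.
have mc : measurable (@cube R d r) by exact: measurable_cube.
apply: (@le_lt_trans _ _ (lebesgue_rV (@cube R d r))).
  by apply: le_measure; rewrite ?inE.
by rewrite lebesgue_rV_cube ?ltry// ltW.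
Qed.

Lemma body_volume_gt0 : 0 < V.
Proof. by have [_ _] := hK; rewrite body_volume_fin lte_fin. Qed.

Lemma integrable_affine (c : R) (y : 'rV[R]_d) :
  (@lebesgue_rV R d).-integrable K (EFin \o (fun x => c + dot y x)).
Proof.
have [cK _ V0] := hK; have [r r0 Kr] := compact_rV_cube cK.
apply: measurable_bounded_integrable => //.
- by rewrite [X in (X < _)%E]body_volume_fin ltry.
- apply: measurable_funTS; apply: measurable_funD => //.
  exact: measurable_rV_dot.
- exists (`|c| + \sum_i `|y ord0 i| * r); split; first exact: num_real.
  move=> M ltM x Kx; apply: le_trans (ltW ltM).
  apply: (le_trans (ler_normD _ _)); apply: lerD => //.
  apply: (le_trans (ler_norm_sum _ _ _)); apply: ler_sum => i _.
  by rewrite normrM ler_wpM2l//; exact: Kr.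
Qed.

Lemma centroid_coord i : \int[lebesgue_rV]_(x in K) (x ord0 i) = 0.
Proof.
have /rowP/(_ i) := hc; rewrite !mxE => /eqP.
by rewrite mulf_eq0 invr_eq0 gt_eqF ?body_volume_gt0//= => /eqP.
Qed.

Lemma integral_dot (y : 'rV[R]_d) : \int[lebesgue_rV]_(x in K) dot y x = 0.
Proof.
have icoord i : (@lebesgue_rV R d).-integrable K (fun x => (x ord0 i)%:E).
  have := integrable_affine 0 (axis i); apply: eq_integrable => // x _ /=.
  by rewrite dot_axisl add0r.
rewrite /Rintegral /dot.
under eq_integral do rewrite -sumEFin.
rewrite (@integral_sum _ _ _ _ K mK _ (fun i x => (y ord0 i * x ord0 i)%:E)); last first.
  by move=> i; have := integrableZl mK (y ord0 i) (icoord i).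
rewrite big1// => i _; under eq_integral do rewrite EFinM.
rewrite integralZl// (_ : integral _ _ _ = 0%E) ?mule0//.
rewrite -[LHS]fineK; last exact: integrable_fin_num.
by congr EFin; exact: centroid_coord.
Qed.

Lemma integral_affine_fun (c : R) (y : 'rV[R]_d) :
  (\int[lebesgue_rV]_(x in K) (c + dot y x)%:E = (c * V)%:E)%E.
Proof.
rewrite -[LHS]fineK; last exact/integrable_fin_num/integrable_affine.
congr EFin; transitivity (\int[lebesgue_rV]_(x in K) (c + dot y x)) => //.
rewrite RintegralD//; last 2 first.
- have := integrable_affine c 0; apply: eq_integrable => // x _ /=.
  by rewrite /dot big1 ?addr0// => i _; rewrite mxE mul0r.
- by have := integrable_affine 0 y; apply: eq_integrable => // x _ /=; rewrite add0r.
by rewrite integral_dot addr0 Rintegral_cst.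
Qed.

(** A functional that is nonnegative on [K] integrates to 0 over [K] and hence
    vanishes almost everywhere there, whereas hyperplanes are null. *)
Lemma no_supporting_functional (y : 'rV[R]_d) : y != 0 ->
  ~ forall x, K x -> 0 <= dot y x.
Proof.
move=> y0 yK.
have mdot : measurable_fun K (fun x => (dot y x)%:E).
  by apply/measurable_EFinP; apply: measurable_funTS; exact: measurable_rV_dot.
have I0 : (\int[lebesgue_rV]_(x in K) `|(dot y x)%:E| = 0)%E.
  rewrite (_ : 0%E = (0 * V)%:E); last by rewrite mul0r.
  rewrite -(integral_affine_fun 0 y); apply: eq_integral => x /[!inE] Kx.
  by rewrite add0r gee0_abs// lee_fin yK.
have [N [mN N0 KN]] := (ae_eq_integral_abs (@lebesgue_rV R d) mK mdot).1 I0.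
pose H := [set x : 'rV[R]_d | dot y x = 0].
have H0 : lebesgue_rV H = 0%E by exact: hyperplane_null.
have mH : measurable H.
  rewrite -[X in measurable X]setTI.
  exact: measurable_rV_dot (measurable_set1 (0 : R)).
have := body_volume_gt0; rewrite -lte_fin -body_volume_fin => /lt_geF/negP; apply.
apply: (@le_trans _ _ (lebesgue_rV (N `|` H))).
  apply: le_measure; rewrite ?inE//; first exact: measurableU.
  move=> x Kx; have [Hx|nHx] := pselect (H x); [by right|left].
  by apply: KN => /= /(_ Kx) [] Hx; exact: nHx.
by apply: (le_trans (measureU2 _ mN mH)); rewrite [X in (X + _)%E]N0 [X in (_ + X)%E]H0 adde0.
Qed.

(** A half-axis that avoided [K] would give, by separation, a nonzero functional
    which is nonnegative on [K]. *)
Lemma body_meets_axis (i : 'I_d) (s : R) : s != 0 ->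
  exists2 c : R, 0 < c & K (c *: (s *: axis i)).
Proof.
move=> s0; apply: contrapT => noc.
have [] := @convex_separation R d K i s _ s0.
- move=> x y t Kx Ky /andP[t0 t1]; have [_ Kconv _] := hK.
  by apply: convex_set_comb => //; rewrite !ltW.
- by move=> c c0 Kc; apply: noc; exists c.
- by move=> y y0 yK; exact: (no_supporting_functional y0 yK).
Qed.

End centered_body.

(** [x] is the average of the [d] points [d x_i e_i], and each of them lies on
    the segment from [- c e_i] to [c e_i]. *)
Lemma cross_polytope_cube (R : realType) (d : nat) (K : set 'rV[R]_d) (c : R) :
  (0 < d)%N -> convex_set K -> 0 < c -> (forall i, K (c *: axis i)) ->
  (forall i, K (- c *: axis i)) -> cube (c / d%:R) `<=` K.
Proof.
case: d K => // m K _ Kconv c0 Kp Km x xc.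
have m0 : (m.+1%:R : R) != 0 by rewrite pnatr_eq0.
rewrite (_ : x = m.+1%:R^-1 *: \sum_i ((m.+1%:R * x ord0 i) *: axis i)).
  apply: convex_average => // i.
  apply: (convex_symmetric_axis Kconv c0 (Kp i) (Km i)).
  have := xc i; rewrite normrM ger0_norm// ler_pdivlMr ?ltr0n//.
  by rewrite mulrC.
under eq_bigr do rewrite -scalerA.
rewrite -scaler_sumr scalerA mulVf// scale1r; apply/rowP => j.
rewrite summxE (bigD1 j)//= !mxE !eqxx/= mulr1 big1 ?addr0// => i ij.
by rewrite !mxE eqxx/= eq_sym (negbTE ij) mulr0.
Qed.

Section interior.
Variables (R : realType) (d : nat) (K : set 'rV[R]_d).
Hypotheses (hd : (0 < d)%N) (hK : convex_body K) (hc : centroid K = 0).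

(** [K] contains a point on each side of the origin along an axis. *)
Lemma origin_in_body : K 0.
Proof.
have [_ Kconv _] := hK.
have [a a0 Ka] := body_meets_axis hK hc (Ordinal hd) (oner_neq0 R).
have m1 : -1 != 0 :> R by rewrite oppr_eq0 oner_neq0.
have [b b0 Kb] := body_meets_axis hK hc (Ordinal hd) m1.
rewrite (_ : 0 = (1 - a / (a + b)) *: (a *: (1 *: axis (Ordinal hd))) +
  (a / (a + b)) *: (b *: (-1 *: axis (Ordinal hd)))).
  apply: convex_set_comb => //; apply/andP; split.
    by rewrite divr_ge0// ltW// addr_gt0.
  by rewrite ler_pdivrMr ?addr_gt0// mul1r lerDl ltW.
have ab : a + b != 0 by rewrite gt_eqF// addr_gt0.
rewrite !scalerA -scalerDl [X in X *: _](_ : _ = 0) ?scale0r//.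
by field.
Qed.

Lemma body_star (x : 'rV[R]_d) (t : R) : K x -> 0 <= t <= 1 -> K (t *: x).
Proof.
have [_ Kconv _] := hK => Kx t01.
by have := convex_set_comb Kconv origin_in_body Kx t01; rewrite scaler0 add0r.
Qed.

Lemma body_interior : exists2 delta : R, 0 < delta & cube delta `<=` K.
Proof.
have [_ Kconv _] := hK.
have m1 : -1 != 0 :> R by rewrite oppr_eq0 oner_neq0.
have /choice[a aP] : forall i, exists a : R, 0 < a /\ K (a *: (1 *: axis i)).
  by move=> i; have [a a0 Ka] := body_meets_axis hK hc i (oner_neq0 R); exists a.
have /choice[b bP] : forall i, exists b : R, 0 < b /\ K (b *: (-1 *: axis i)).
  by move=> i; have [b b0 Kb] := body_meets_axis hK hc i m1; exists b.
(* Shrinking towards the origin gives the same length [c] to all half-axes, so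
   that [K] contains a cross-polytope. *)
pose c := \big[Num.min/1]_i Num.min (a i) (b i).
have c0 : 0 < c.
  rewrite /c; elim/big_ind : _ => // [x y x0 y0|i _].
    by rewrite lt_min x0.
  by rewrite lt_min (aP i).1 (bP i).1.
have cle i : c <= a i /\ c <= b i.
  by apply/andP; rewrite -le_min /c; exact: bigmin_le_cond.
have Kp i : K (c *: axis i).
  have [ai Ka] := aP i; rewrite (_ : _ *: _ = (c / a i) *: (a i *: (1 *: axis i))).
    apply: body_star => //; apply/andP; split; first by rewrite divr_ge0// ltW.
    by rewrite ler_pdivrMr// mul1r; have [] := cle i.
  by rewrite !scalerA mulr1 divfK// gt_eqF.
have Km i : K (- c *: axis i).
  have [bi Kb] := bP i; rewrite (_ : _ *: _ = (c / b i) *: (b i *: (-1 *: axis i))).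
    apply: body_star => //; apply/andP; split; first by rewrite divr_ge0// ltW.
    by rewrite ler_pdivrMr// mul1r; have [] := cle i.
  by rewrite !scalerA divfK ?gt_eqF// mulrN1.
exists (c / d%:R) => [|x xc]; first by rewrite divr_gt0// ltr0n.
exact: (cross_polytope_cube hd Kconv c0 Kp Km).
Qed.

End interior.

(** * The autocorrelation of a convex body *)

Section autocorrelation.
Variables (R : realType) (d : nat) (K : set 'rV[R]_d).
Hypothesis hK : convex_body K.

Definition overlap (x : 'rV[R]_d) : set 'rV[R]_d := K `&` [set u | K (x - u)].

(** The value at [x] of the convolution of the indicator of [K] with itself. *)
Definition autocorrelation (x : 'rV[R]_d) : R := fine (lebesgue_rV (overlap x)).

Definition overlap_indic (x u : 'rV[R]_d) : R := \1_K u * \1_K (x - u).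

Let mK : measurable K := body_measurable hK.
Let V : R := fine (lebesgue_rV K).

Lemma measurable_rV_sub : measurable_fun [set: 'rV[R]_d * 'rV[R]_d] (fun z => z.1 - z.2).
Proof.
apply: measurable_fun_rVP => i; under eq_fun do rewrite !mxE.
apply: measurable_funB.
  exact: (measurableT_comp (measurable_rV_coord i) measurable_fst).
exact: (measurableT_comp (measurable_rV_coord i) measurable_snd).
Qed.

Lemma measurable_overlap_indic :
  measurable_fun [set: 'rV[R]_d * 'rV[R]_d] (fun z => overlap_indic z.1 z.2).
Proof.
apply: measurable_funM.
  exact: (measurableT_comp (measurable_indic mK) measurable_snd).
exact: (measurableT_comp (measurable_indic mK) measurable_rV_sub).
Qed.

Lemma overlap_indicE x : overlap_indic x = \1_(overlap x).
Proof.
apply/funext => u; rewrite /overlap_indic !indicE -natrM mulnb; congr (_%:R).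
by congr nat_of_bool; apply/andP/idP; rewrite !inE.
Qed.

Lemma overlap_indic_bounded_support (r : R) x : K `<=` cube r ->
  bounded_support 1 r (overlap_indic x).
Proof.
move=> Kr; split.
- exact: measurableT_comp measurable_overlap_indic (measurable_pair1 x).
- by move=> u; rewrite overlap_indicE indicE ler0n lern1 leq_b1.
- move=> u ur; rewrite /overlap_indic indicE memNset ?mul0r// => /Kr; exact: ur.
Qed.

Lemma measurable_overlap x : measurable (overlap x).
Proof.
apply: measurableI => //; rewrite -[X in measurable X]setTI.
have m := measurableT_comp measurable_rV_sub (measurable_pair1 x).
exact: (m _ K mK).
Qed.

Lemma overlap_integral x :
  lebesgue_rV (overlap x) = (\int[lebesgue_rV]_u (overlap_indic x u)%:E)%E.
Proof.
rewrite overlap_indicE integral_indic ?setIT//; exact: measurable_overlap.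
Qed.

Lemma autocorrelationE x :
  (\int[lebesgue_rV]_u (overlap_indic x u)%:E)%E = (autocorrelation x)%:E.
Proof.
have [cK _ _] := hK; have [r r0 Kr] := compact_rV_cube cK.
have := bounded_support_integral (ltW r0) (overlap_indic_bounded_support x Kr).
move=> /andP[a0 aM]; rewrite -!overlap_integral in a0 aM *.
by rewrite /autocorrelation fineK// ge0_fin_numE// (le_lt_trans aM)// ltry.
Qed.

Lemma autocorrelation_ge0 x : 0 <= autocorrelation x.
Proof. exact: fine_ge0. Qed.

(** By convexity, [K /\ (z - K)] contains
    [(1 - t) (K /\ (x - K)) + t (K /\ (y - K))] for [z = (1 - t) x + t y];
    Prekopa-Leindler applied to the indicators turns this inclusion into an
    inequality between volumes. *)
Lemma autocorrelation_log_concave x y (t : R) : 0 < t < 1 ->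
  autocorrelation x `^ (1 - t) * autocorrelation y `^ t <=
  autocorrelation ((1 - t) *: x + t *: y).
Proof.
move=> /[dup] t01 /andP[t0 t1].
have [cK Kconv _] := hK; have [r r0 Kr] := compact_rV_cube cK.
rewrite /autocorrelation !overlap_integral.
apply: (prekopa_leindler t01 (ltW r0)); do ?exact: overlap_indic_bounded_support.
move=> u v; rewrite !overlap_indicE.
have t01' : 0 <= t <= 1 by rewrite !ltW.
rewrite [X in X `^ _]indicE; have [ux|ux] := boolP (u \in overlap x); last first.
  by rewrite powR0 ?mul0r ?indicE// gt_eqF// subr_gt0.
rewrite [X in _ * X `^ _]indicE; have [vy|vy] := boolP (v \in overlap y); last first.
  by rewrite [X in _ * X]powR0 ?mulr0 ?indicE// gt_eqF.
rewrite !powR1 mul1r indicE mem_set//.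
move: ux vy; rewrite !inE => -[Ku Kxu] [Kv Kyv]; split; first exact: convex_set_comb.
rewrite /= (_ : _ - _ = (1 - t) *: (x - u) + t *: (y - v)); first exact: convex_set_comb.
by rewrite !scalerBr opprD addrACA.
Qed.

(** Twice the centroid of [K] is the centroid of the law of a sum of two
    independent uniform points of [K], whose density is proportional to the
    autocorrelation. *)
Lemma autocorrelation_integral_affine (r c : R) (y : 'rV[R]_d) :
  centroid K = 0 -> K `<=` cube r -> (forall x, cube (2 * r) x -> 0 <= c + dot y x) ->
  (\int[lebesgue_rV]_x (autocorrelation x * (c + dot y x))%:E = (c * V ^+ 2)%:E)%E.
Proof.
move=> hc Kr y0.
pose w (x u : 'rV[R]_d) : R := overlap_indic x u * (c + dot y x).
have ind0 x u : 0 <= overlap_indic x u by rewrite overlap_indicE indicE ler0n.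
have sup x u : ~ cube (2 * r) x -> overlap_indic x u = 0.
  move=> xr; rewrite overlap_indicE indicE memNset// => -[/Kr ur /Kr xur]; apply: xr => i.
  have := ur i; have := xur i; rewrite !mxE => h1 h2.
  by rewrite -(subrK (u ord0 i) (x ord0 i)) (le_trans (ler_normD _ _))//; lra.
have w0 x u : 0 <= w x u.
  rewrite /w; have [/y0 ?|/sup->] := pselect (cube (2 * r) x); last by rewrite mul0r.
  exact: mulr_ge0.
have mw : measurable_fun [set: 'rV[R]_d * 'rV[R]_d] (fun z => (w z.1 z.2)%:E).
  apply/measurable_EFinP; apply: measurable_funM; first exact: measurable_overlap_indic.
  apply: measurable_funD => //.
  exact: (measurableT_comp (measurable_rV_dot y) measurable_fst).
transitivity (\int[lebesgue_rV]_x \int[lebesgue_rV]_u (w x u)%:E)%E.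
  apply: eq_integral => x _; rewrite EFinM -autocorrelationE.
  have [/y0 lx|xr] := pselect (cube (2 * r) x); last first.
    rewrite !integral0_eq ?mul0e// => u _; first by rewrite /w sup// mul0r.
    by rewrite sup.
  rewrite -ge0_integralZr//.
  - apply/measurable_EFinP.
    exact: measurableT_comp measurable_overlap_indic (measurable_pair1 x).
  - by move=> u _; rewrite lee_fin.
rewrite (fubini_tonelli (m1 := @lebesgue_rV R d) (m2 := @lebesgue_rV R d)
  (fun z => (w z.1 z.2)%:E))//=; last by move=> z; rewrite lee_fin.
transitivity (\int[lebesgue_rV]_(u in K) ((c * V) + dot (V *: y) u)%:E)%E; last first.
  by rewrite integral_affine_fun// -mulrA -expr2.
rewrite [RHS]integral_mkcond; apply: eq_integral => u _.
rewrite /patch; case: ifPn => uK; last first.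
  by rewrite integral0_eq// => x _; rewrite /w /overlap_indic indicE (negbTE uK) !mul0r.
transitivity (\int[lebesgue_rV]_x (\1_K (x - u) * (c + dot y x))%:E)%E.
  by apply: eq_integral => x _; rewrite /w /overlap_indic indicE uK mul1r.
have := @integral_rV_affine R d (fun x => (\1_K (x - u) * (c + dot y x))%:E) 1 u ltr01.
rewrite invr1 expr1n mul1e => <-; last 2 first.
- have := measurableT_comp mw (measurable_pair2 u); congr measurable_fun.
  by apply/funext => x /=; rewrite /w /overlap_indic [\1_K u]indicE uK mul1r.
- by move=> x; have := w0 x u; rewrite /w /overlap_indic [\1_K u]indicE uK mul1r lee_fin.
transitivity (\int[lebesgue_rV]_(x in K) ((c + dot y u) + dot y x)%:E)%E.
  rewrite [RHS]integral_mkcond; apply: eq_integral => x _.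
  rewrite scale1r addrK dotDr /patch indicE; case: ifP => _; last by rewrite mul0r.
  by rewrite mul1r; congr EFin; ring.
by rewrite integral_affine_fun// dotZl; congr EFin; rewrite /V; ring.
Qed.

Lemma measurable_autocorrelation : measurable_fun [set: 'rV[R]_d] autocorrelation.
Proof.
apply/measurable_EFinP; rewrite (_ : EFin \o _ =
    fun x => (\int[lebesgue_rV]_u (overlap_indic x u)%:E)%E); last first.
  by apply/funext => x; rewrite autocorrelationE.
apply: (measurable_fun_fubini_tonelli_F (m2 := @lebesgue_rV R d)
  (fun z => (overlap_indic z.1 z.2)%:E)) => [|z].
  apply/measurable_EFinP; exact: measurable_overlap_indic.
by rewrite lee_fin overlap_indicE indicE ler0n.
Qed.

(** If [u] and [x - u] have an [i]-th coordinate at most [M] and [x_i] is at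
    least [2 M - e], then [u_i] is at least [M - e]: the overlap lies in a slab
    of width [e] inside the cube. *)
Lemma autocorrelation_cap (r M e : R) (i : 'I_d) (x : 'rV[R]_d) : 0 <= r -> 0 <= e ->
  K `<=` cube r -> (forall u, K u -> u ord0 i <= M) -> 2 * M - e <= x ord0 i ->
  autocorrelation x <= e * (2 * r) ^+ d.-1.
Proof.
move=> r0 e0 Kr KM xM.
pose A (j : 'I_d) : set R := if j == i then `[M - e, M]%classic else `[- r, r]%classic.
have mA j : measurable (A j) by rewrite /A; case: ifP => _; exact: measurable_itv.
have sub : overlap x `<=` [set u | forall j, A j (u ord0 j)].
  move=> u [Ku Kxu] j; rewrite /A; case: ifP => [/eqP ->|_] /=; rewrite in_itv/=.
    have := KM _ Kxu; rewrite !mxE => h; apply/andP; split; last exact: KM.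
    by lra.
  by rewrite -ler_norml; exact: Kr.
have : (lebesgue_rV (overlap x) <= (e * (2 * r) ^+ d.-1)%:E)%E.
  apply: (@le_trans _ _ (lebesgue_rV [set u : 'rV[R]_d | forall j, A j (u ord0 j)])).
    apply: le_measure => //; rewrite inE; first exact: measurable_overlap.
    exact: measurable_rV_pi.
  rewrite lebesgue_rV_box// (bigD1 i)//= {1}/A eqxx EFinM.
  apply: lee_pmul => //.
  - by apply: prode_ge0 => j _; exact: measure_ge0.
  - rewrite lebesgue_measure_itv/= lte_fin; case: ifP => _; last by rewrite lee_fin.
    by rewrite -EFinD lee_fin; lra.
  rewrite (eq_bigr (fun=> (2 * r)%:E)) => [|j /negbTE ji]; last first.
    rewrite /A ji lebesgue_measure_itv/= lte_fin; case: ltP => rr;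
      rewrite -?EFinD; congr EFin; lra.
  by rewrite prodEFin lee_fin prodr_const cardC1 card_ord.
by rewrite overlap_integral autocorrelationE lee_fin.
Qed.

End autocorrelation.

(** * The Milman-Pajor inequality *)

Section milman_pajor.
Variables (R : realType) (d : nat) (K : set 'rV[R]_d).
Hypotheses (hd : (0 < d)%N) (hK : convex_body K) (hc : centroid K = 0).
Let V : R := fine (lebesgue_rV K).
Local Notation F := (autocorrelation K).

(** For [x] in the half-size cube, the half-size cube lies in [K] and in
    [x - K]. *)
Lemma autocorrelation_positive (delta : R) x : 0 < delta -> cube delta `<=` K ->
  cube (delta / 2) x -> 0 < F x.
Proof.
move=> d0 dK xd.
have mc : measurable (@cube R d (delta / 2)) by exact: measurable_cube.
have : (lebesgue_rV (@cube R d (delta / 2)) <= lebesgue_rV (overlap K x))%E.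
  apply: le_measure; rewrite ?inE//; first exact: measurable_overlap.
  move=> u ud; split; apply: dK => i; first by have := ud i; lra.
  have := ud i; have := xd i; rewrite !mxE => h1 h2.
  by rewrite (le_trans (ler_normB _ _))//; lra.
rewrite (lebesgue_rV_cube _ (ltW (divr_gt0 d0 (ltr0n _ 2)))).
rewrite overlap_integral// autocorrelationE// lee_fin; apply: lt_le_trans.
by rewrite exprn_gt0// mulr_gt0// divr_gt0.
Qed.

(** The linear form of the supporting exponential: multiply
    [F x <= F 0 exp u] by [1 - u <= exp (- u)], where [u] is [dot y x]. *)
Lemma autocorrelation_support : exists y : 'rV[R]_d, forall x,
  F x * (1 - dot y x) <= F 0.
Proof.
have [delta d0 dK] := body_interior hd hK hc.
have cub (s : R) i : `|s| <= delta / 2 -> cube (delta / 2) (s *: axis i : 'rV[R]_d).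
  move=> sd j; rewrite !mxE eqxx/=; case: (j == i); rewrite ?mulr1// mulr0 normr0.
  by rewrite divr_ge0// ltW.
have d2 : 0 < delta / 2 by rewrite divr_gt0.
have F0 : 0 < F 0.
  by apply: (autocorrelation_positive d0 dK) => i; rewrite mxE normr0 ltW.
have [|i|i|y yF] := @log_concave_support R d F (delta / 2)
  (@autocorrelation_ge0 _ _ _) F0 _ d2.
- by move=> x y t t01; exact: autocorrelation_log_concave.
- apply: (autocorrelation_positive d0 dK); apply: cub.
  by rewrite ger0_norm// ltW.
- apply: (autocorrelation_positive d0 dK); apply: cub.
  by rewrite normrN ger0_norm// ltW.
exists y => x; have [y1|y1] := leP (dot y x) 1; last first.
  by rewrite (le_trans _ (ltW F0))// mulr_ge0_le0 ?autocorrelation_ge0//; lra.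
apply: (@le_trans _ _ (F x * expR (- dot y x))).
  by rewrite ler_wpM2l ?autocorrelation_ge0// expR_ge1Dx.
by rewrite expRN ler_pdivrMr ?expR_gt0.
Qed.

(** Near a point [2 k] of [2 K] whose first coordinate is almost maximal,
    convexity leaves room for a small homothetic copy of [K] inside [2 K]; there
    [autocorrelation_cap] makes the autocorrelation as small as desired. *)
Lemma autocorrelation_small (eta : R) : 0 < eta -> exists s b,
  [/\ 0 < s, forall x, K x -> exists2 z, K z & s *: x + b = 2 *: z
    & forall x, K x -> F (s *: x + b) <= eta].
Proof.
move=> eta0; have [cK Kconv _] := hK; have [r r0 Kr] := compact_rV_cube cK.
pose i := Ordinal hd.
pose S := [set x ord0 i | x in K].
have hS : has_sup S.
  split; first by exists 0, 0; rewrite ?mxE//; exact: origin_in_body.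
  exists r => _ [x Kx <-]; apply: (le_trans (ler_norm _)); exact: Kr.
pose C := (2 * r) ^+ d.-1.
have C0 : 0 < C by rewrite exprn_gt0// mulr_gt0.
(* By [autocorrelation_cap], [F x <= e C = eta] once [x_i] is within [e] of its
   maximum [2 sup S] over [2 K]. *)
pose e := eta / C.
have e0 : 0 < e by rewrite divr_gt0.
have [_ [k Kk <-] kM] := sup_adherent (divr_gt0 e0 (ltr0n R 4)) hS.
(* Moving from [k] towards a point of [K] by a ratio [s] lowers the coordinate by
   at most [2 r s <= e / 4]. *)
pose s := e / (8 * r + e).
have p0 : 0 < 8 * r + e by rewrite addr_gt0// mulr_gt0.
have s0 : 0 < s by rewrite divr_gt0.
have s1 : s <= 1 by rewrite ler_pdivrMr// mul1r lerDr; lra.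
have sr : 8 * r * s <= e.
  by rewrite /s mulrA ler_pdivrMr// mulrC ler_wpM2l ?ltW//; lra.
exists (2 * s), (2 *: ((1 - s) *: k)).
have E x : (2 * s) *: x + 2 *: ((1 - s) *: k) = 2 *: ((1 - s) *: k + s *: x).
  by rewrite -scalerA -scalerDr addrC.
split; first by rewrite mulr_gt0.
  move=> x Kx; exists ((1 - s) *: k + s *: x) => //.
  by apply: convex_set_comb => //; rewrite ltW.
move=> x Kx; rewrite E.
have -> : eta = e * C by rewrite /e divfK// gt_eqF.
apply: (@autocorrelation_cap _ _ _ hK r (sup S) e i) => //; try exact: ltW.
  by move=> u Ku; apply: sup_upper_bound => //; exists u.
rewrite !mxE; have := Kr _ Kk i; have := Kr _ Kx i; rewrite !ler_norml.
move=> /andP[x1 x2] /andP[k1 k2].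
have : s * (k ord0 i - x ord0 i) <= s * (2 * r) by rewrite ler_wpM2l// ?(ltW s0)//; lra.
by move: sr kM; lra.
Qed.

(** Integration of [F x (1 - dot y x) <= F 0] over [2 K].  Adding
    [(Y - 1) F x] to both sides, with [Y] an upper bound of [dot y x] on a cube
    containing [2 K], makes the integrands nonnegative, and the added terms
    cancel after integration.  On the copy [B] of [K] provided by
    [autocorrelation_small] the left-hand side is at most [F 0 / 2], whence the
    strict inequality. *)
Theorem milman_pajor : V < 2 ^+ d * F 0.
Proof.
have [cK Kconv _] := hK; have [r r0 Kr] := compact_rV_cube cK.
have V0 : 0 < V := body_volume_gt0 hK.
have [delta d0 dK] := body_interior hd hK hc.
have F0 : 0 < F 0.
  by apply: (autocorrelation_positive d0 dK) => i; rewrite mxE normr0 divr_ge0// ltW.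
have [y yF] := autocorrelation_support.
pose Y : R := 1 + \sum_i `|y ord0 i| * (2 * r).
have Y1 : 1 <= Y.
  by rewrite lerDl sumr_ge0// => i _; rewrite !mulr_ge0// ltW.
have dotY x : cube (2 * r) x -> `|dot y x| <= Y.
  move=> xr; apply: (@le_trans _ _ (\sum_i `|y ord0 i| * (2 * r))); last by rewrite lerDr.
  apply: (le_trans (ler_norm_sum _ _ _)); apply: ler_sum => i _.
  by rewrite normrM ler_wpM2l//; exact: xr.
pose eta := F 0 / (2 * (1 + Y)).
have eta0 : 0 < eta by rewrite divr_gt0// mulr_gt0// addr_gt0// (lt_le_trans ltr01).
have [s [b [s0 B2 Bsmall]]] := autocorrelation_small eta0.
pose D := [set 2 *: x + 0 | x in K].
pose B := [set s *: x + b | x in K].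
have mK := body_measurable hK.
have mD : measurable D by exact: measurable_affine_image.
have mB : measurable B by exact: measurable_affine_image.
have D2 z : K z -> D (2 *: z) by move=> Kz; exists z => //; rewrite addr0.
have BD : B `<=` D by move=> _ [x /B2[z Kz ->] <-]; exact: D2.
have Dcube : D `<=` cube (2 * r).
  move=> _ [x Kx <-] i; rewrite addr0 mxE normrM ger0_norm// ler_wpM2l//.
  exact: Kr.
have FD x : ~ D x -> F x = 0.
  move=> nD; rewrite /autocorrelation (_ : overlap K x = set0) ?measure0//.
  rewrite -subset0 => u [Ku Kxu]; apply: nD.
  have -> : x = 2 *: ((1 - 2^-1) *: u + 2^-1 *: (x - u)).
    rewrite scalerDr !scalerA; apply/rowP => j; rewrite !mxE; lra.
  apply: D2; apply: convex_set_comb => //.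
  by rewrite invr_ge0 ler0n invf_le1// ler1n.
(* The inequality to be integrated; it reads [0 <= 0] outside of [D = 2 K]. *)
have key x : F x * (Y + dot (- y) x) + F 0 / 2 * \1_B x <=
    F 0 * \1_D x + (Y - 1) * F x.
  have -> : dot (- y) x = - dot y x by rewrite -scaleN1r dotZl mulN1r.
  have [Dx|Dx] := pselect (D x); last first.
    rewrite FD// [\1_D x]indicE memNset// [\1_B x]indicE memNset; last by move/BD.
    by rewrite mul0r !mulr0.
  rewrite [\1_D x]indicE mem_set// mulr1 indicE.
  have [Bx|Bx] := pselect (B x); last by rewrite memNset// mulr0; have := yF x; lra.
  rewrite mem_set// mulr1.
  have Fe : F x <= eta by move: Bx => [z Kz <-]; exact: Bsmall.
  have : F x * (1 - dot y x) <= F 0 / 2; last by lra.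
  apply: (@le_trans _ _ (F x * (1 + Y))).
    rewrite ler_wpM2l ?autocorrelation_ge0//.
    by have := dotY _ (Dcube _ Dx); rewrite ler_norml => /andP[? ?]; lra.
  apply: (@le_trans _ _ (eta * (1 + Y))); first by rewrite ler_wpM2r//; lra.
  have Yn0 : 1 + Y != 0 by rewrite gt_eqF//; lra.
  by rewrite le_eqVlt (_ : eta * _ = F 0 / 2) ?eqxx// /eta; field.
have I1 := autocorrelation_integral_affine (r := r) (c := Y) (y := - y) hK hc Kr _.
have I2 := autocorrelation_integral_affine (r := r) (c := 1) (y := 0) hK hc Kr _.
have dot0 x : dot 0 x = 0 :> R by rewrite /dot big1// => i _; rewrite mxE mul0r.
have {}I1 : (\int[lebesgue_rV]_x (F x * (Y + dot (- y) x))%:E = (Y * V ^+ 2)%:E)%E.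
  apply: I1 => x /dotY; rewrite -scaleN1r dotZl mulN1r ler_norml => /andP[? ?]; lra.
have {}I2 : (\int[lebesgue_rV]_x (F x)%:E = (V ^+ 2)%:E)%E.
  rewrite -[RHS](_ : (1 * V ^+ 2)%:E = _)%E; last by rewrite mul1r.
  rewrite -I2; last by move=> x _; rewrite dot0 addr0.
  by apply: eq_integral => x _; rewrite dot0 addr0 mulr1.
have mF := measurable_autocorrelation hK.
have mFE : measurable_fun [set: 'rV[R]_d] (fun x => (F x)%:E) by exact/measurable_EFinP.
have FY0 x : 0 <= F x * (Y + dot (- y) x).
  have [Dx|Dx] := pselect (D x); last by rewrite FD// mul0r.
  rewrite mulr_ge0 ?autocorrelation_ge0//.
  have := dotY _ (Dcube _ Dx).
  by rewrite -scaleN1r dotZl mulN1r ler_norml => /andP[? ?]; lra.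
have mFY : measurable_fun [set: 'rV[R]_d] (fun x => (F x * (Y + dot (- y) x))%:E).
  apply/measurable_EFinP; apply: measurable_funM => //.
  by apply: measurable_funD => //; exact: measurable_rV_dot.
have mI (A : set 'rV[R]_d) c : measurable A ->
    measurable_fun [set: 'rV[R]_d] (fun x => (c * \1_A x)%:E).
  by move=> mA; apply/measurable_EFinP; apply: measurable_funM => //; exact: measurable_indic.
have I0 (A : set 'rV[R]_d) (c v : R) : 0 <= c -> measurable A -> lebesgue_rV A = v%:E ->
    (\int[lebesgue_rV]_x (c * \1_A x)%:E = (c * v)%:E)%E.
  move=> c0 mA Av; under eq_integral do rewrite EFinM.
  rewrite ge0_integralZl//; last by apply/measurable_EFinP; exact: measurable_indic.
  by rewrite integral_indic// setIT [X in (_ * X)%E]Av.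
have VK : lebesgue_rV K = V%:E := body_volume_fin hK.
have VD : lebesgue_rV D = (2 ^+ d * V)%:E by rewrite lebesgue_rV_affine// VK.
have VB : lebesgue_rV B = (s ^+ d * V)%:E by rewrite lebesgue_rV_affine// VK.
have : (\int[lebesgue_rV]_x ((F x * (Y + dot (- y) x))%:E + (F 0 / 2 * \1_B x)%:E) <=
    \int[lebesgue_rV]_x ((F 0 * \1_D x)%:E + ((Y - 1)%:E * (F x)%:E)))%E.
  apply: ge0_le_integral => //.
  - by move=> x _; rewrite lee_fin addr_ge0// mulr_ge0 ?divr_ge0// ?indicE// ltW.
  - by apply: emeasurable_funD => //; exact: mI.
  - by apply: emeasurable_funD; [exact: mI|exact: measurable_funeM].
  - by move=> x _; rewrite -EFinM -!EFinD lee_fin.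
have pI (A : set 'rV[R]_d) c x : 0 <= c -> (0 <= (c * \1_A x)%:E)%E.
  by move=> c0; rewrite lee_fin mulr_ge0// indicE.
have F2 : 0 <= F 0 / 2 by rewrite divr_ge0// ltW.
have pF x : (0 <= (Y - 1)%:E * (F x)%:E)%E.
  by rewrite -EFinM lee_fin mulr_ge0 ?autocorrelation_ge0// subr_ge0.
rewrite !ge0_integralD//; do ?[exact: mI|exact: measurable_funeM|by move=> x _; exact: pF
  |by move=> x _; apply: pI => //; exact: ltW|by move=> x _; rewrite lee_fin].
rewrite I1 (I0 _ _ _ F2 mB VB) (I0 _ _ _ (ltW F0) mD VD).
rewrite ge0_integralZl//; last 2 first.
- by move=> x _; rewrite lee_fin autocorrelation_ge0.
- by rewrite lee_fin; lra.
rewrite I2 -!EFinM -!EFinD lee_fin.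
have : 0 < F 0 / 2 * (s ^+ d * V) by rewrite mulr_gt0 ?divr_gt0// mulr_gt0// exprn_gt0.
move=> h1 h2; rewrite -(ltr_pM2r V0).
by move: h1 h2; rewrite -!expr2; lra.
Qed.

End milman_pajor.

(** * Lattice points and the first minimum *)

Lemma integer_lattice_cube_finite (R : realType) (d : nat) (r : R) :
  finite_set (cube r `&` @integer_lattice R d).
Proof.
have [m rm] : exists m : nat, r <= m%:R.
  by exists (Num.truncn `|r|).+1; rewrite (le_trans (ler_norm r))// ltW// truncnS_gt.
(* Shifting by [m] turns coordinates between [- m] and [m] into ordinals. *)
pose g (f : {ffun 'I_d -> 'I_(m + m).+1}) : 'rV[R]_d := \row_i ((f i)%:R - m%:R).
apply: (@sub_finite_set _ _ (g @` setT)); last exact/finite_image/finite_finset.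
move=> x [xr /mxOverP xZ].
have /choice[k kx] : forall i, exists k : 'I_(m + m).+1, x ord0 i = k%:R - m%:R.
  move=> i; have /intrP[z zx] := xZ ord0 i.
  have : `|x ord0 i| <= m%:R by apply: le_trans (xr i) rm.
  rewrite zx -intr_norm -[m%:R]/((m%:Z)%:~R) ler_int ler_norml => /andP[z1 z2].
  have : `|(z + m%:Z)%R|%N = z + m%:Z :> int by rewrite gez0_abs// -lerBlDr sub0r.
  set q := `|_|%N => qE.
  have qm : (q < (m + m).+1)%N.
    by rewrite ltnS -lez_nat qE PoszD lerD2r.
  exists (Ordinal qm); rewrite /= -[q%:R]/((q%:Z)%:~R) qE rmorphD/=.
  by rewrite addrK.
by exists [ffun i => k i] => //; apply/rowP => i; rewrite mxE ffunE (kx i).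
Qed.

Lemma exprn_le_left_limit (R : realType) (a b T : R) n : 0 < T ->
  (forall t, 0 < t -> t < T -> a * t ^+ n <= b) -> a * T ^+ n <= b.
Proof.
move=> T0 H; pose A := [set t | a * t ^+ n <= b].
have clA : closed A.
  have cont : continuous (fun t : R => a * t ^+ n : R).
    by move=> t; apply: cvgMr; exact: exprn_continuous.
  apply: (@preimage_closed _ _ (fun t : R => a * t ^+ n : R) [set x | x <= b]
    (fun t _ => cont t)); exact: closed_le.
have : closure `]0, T[%classic T.
  have := @closure_sup R `]0, T[%classic; rewrite sup_itv//; apply.
  - by exists (T / 2); rewrite /= in_itv/= ; apply/andP; split; lra.
  - by exists T => x /=; rewrite in_itv/= => /andP[_ /ltW].
move=> clT; apply: clA; apply: closure_subset clT.
by move=> t /=; rewrite in_itv/= => /andP[? ?]; exact: H.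
Qed.

Section successive_minimum.
Variables (R : realType) (d : nat) (K : set 'rV[R]_d).
Hypotheses (hd : (0 < d)%N) (hK : convex_body K) (hc : centroid K = 0).
Local Notation lambda1 := (first_successive_minimum K).

Let Lambda := [set l : R | 0 < l /\
    [set l *: x | x in K] `&` @integer_lattice R d <> [set 0]].

Lemma integer_lattice0 : @integer_lattice R d 0.
Proof. by apply/mxOverP => i j; rewrite mxE; exact: intr0 || exact: rpred0. Qed.

Lemma successive_scalingP (l : R) : Lambda l <-> 0 < l /\
  exists z, [/\ z != 0, integer_lattice z & K (l^-1 *: z)].
Proof.
have K0 : K 0 := origin_in_body hd hK hc.
split=> -[l0 H]; split=> //; last first.
  move: H => [z [z0 zZ Kz]] E; have : [set (0 : 'rV[R]_d)] z.
    rewrite -E; split => //; exists (l^-1 *: z) => //.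
    by rewrite scalerA mulfV ?gt_eqF// scale1r.
  by move=> /= zE; move: z0; rewrite zE eqxx.
apply: contrapT => noz; apply: H; apply/seteqP; split=> [_ [[x Kx <-] lxZ]|_ ->].
  apply: contrapT => /= /eqP lx0; apply: noz; exists (l *: x); split => //.
  by rewrite scalerA mulVf ?gt_eqF// scale1r.
by split; [exists 0 => //; rewrite scaler0|exact: integer_lattice0].
Qed.

Lemma axis_integer_lattice i : @integer_lattice R d (axis i).
Proof. by apply/mxOverP => a b; rewrite mxE; case: andP => _; rewrite ?rpred0 ?rpred1. Qed.

(** A factor [l] is admissible when [t z] lies in [K] for [t = l^-1] and some
    nonzero lattice point [z].  Once [t] is bounded below by a known admissible
    value [t1], only finitely many [z] are relevant, so that the admissible [t]
    form a closed bounded set. *)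
Lemma successive_minimum_exists : exists l, Lambda l /\ lbound Lambda l.
Proof.
have [cK Kconv _] := hK; have [r r0 Kr] := compact_rV_cube cK.
have clK : closed K by apply: compact_closed => //; exact: norm_hausdorff.
have [t1 t10 Kt1] := body_meets_axis hK hc (Ordinal hd) (oner_neq0 R).
rewrite scale1r in Kt1.
pose A := [set z | z != 0 /\ (cube (r / t1) `&` @integer_lattice R d) z].
have fA : finite_set A.
  by apply: sub_finite_set (integer_lattice_cube_finite d (r / t1)) => z [].
have ax0 : axis (Ordinal hd) != 0 :> 'rV[R]_d.
  by rewrite -[axis _]scale1r axis_neq0// oner_neq0.
pose T := [set t | t1 <= t] `&` \bigcup_(z in A) [set t : R | K (t *: z)].
have clT : closed T.
  apply: closedI; first exact: closed_ge.
  apply: closed_bigcup => // z _.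
  have cz : continuous (fun t : R => t *: z) by move=> t; exact: scalel_continuous.
  exact: (preimage_closed (fun t _ => cz t) clK).
have AT t z : t1 <= t -> z != 0 -> integer_lattice z -> K (t *: z) -> T t.
  move=> tt z0 zZ Kz; split => //; exists z => //; split => //; split => // i.
  rewrite ler_pdivlMr//; have := Kr _ Kz i.
  rewrite mxE normrM (@ger0_norm _ t) ?(le_trans (ltW t10))// => h.
  by rewrite mulrC (le_trans _ h)// ler_wpM2r.
have T0 : T !=set0.
  by exists t1; apply: (AT _ (axis (Ordinal hd))) => //; exact: axis_integer_lattice.
have uT : has_ubound T.
  exists r => t [/= t1t [z [z0 [_ /mxOverP zZ]] Kz]].
  have tge0 : 0 <= t by rewrite (le_trans (ltW t10)).
  have [i zi] : exists i, z ord0 i != 0.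
    apply: contrapT => nz; move: z0 => /eqP; apply; apply/rowP => i; rewrite mxE.
    by apply/eqP; apply: contrapT => /negP zi; apply: nz; exists i.
  have := Kr _ Kz i; rewrite mxE normrM (ger0_norm tge0); apply: le_trans.
  by rewrite ler_peMr// norm_intr_ge1.
(* The least scaling factor is the inverse of the greatest element of [T]. *)
have Ts : T (sup T) by apply: clT; exact: closure_sup.
have [/= ts [z [z0 [_ zZ]] Kz]] := Ts.
have s0 : 0 < sup T by rewrite (lt_le_trans t10).
exists (sup T)^-1; split.
  by apply/successive_scalingP; split; rewrite ?invr_gt0//; exists z; rewrite invrK.
move=> l /successive_scalingP[l0 [w [w0 wZ Kw]]].
rewrite -[l]invrK lef_pV2 ?posrE ?invr_gt0//.
have [t1l|] := leP t1 l^-1; last by move=> /ltW/le_trans; apply.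
by apply: ub_le_sup => //; exact: AT Kw.
Qed.

(** The existence of a least scaling factor rules out the default value in the
    definition of [minimum]. *)
Lemma first_successive_minimum_spec : 0 < lambda1 /\
  forall (mu : R) z, 0 < mu -> mu < lambda1 -> integer_lattice z -> K (mu^-1 *: z) -> z = 0.
Proof.
have [l lP] := successive_minimum_exists.
have : Lambda lambda1 /\ lbound Lambda lambda1.
  by apply: (@xgetPex R 0 [set m | Lambda m /\ lbound Lambda m]); exists l.
move=> [[l0 _] lb]; split => // mu z mu0 mul zZ Kz.
apply/eqP; apply: contrapT => /negP z0.
have : Lambda mu by apply/successive_scalingP; split => //; exists z.
by move/lb; rewrite leNgt mul.
Qed.

Lemma lattice_points_finite : finite_set (K `&` @integer_lattice R d).
Proof.
have [cK _ _] := hK; have [r r0 Kr] := compact_rV_cube cK.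
apply: sub_finite_set (integer_lattice_cube_finite d r) => x [Kx xZ].
by split => //; exact: Kr.
Qed.

Lemma integer_latticeB x y : integer_lattice x -> integer_lattice y ->
  @integer_lattice R d (x - y).
Proof.
move=> /mxOverP xZ /mxOverP yZ; apply/mxOverP => i j; rewrite !mxE.
by rewrite rpredB.
Qed.

Local Notation N := (#|` fset_set (K `&` @integer_lattice R d) | ).

(** The copies of [t (K /\ (- K))] centered at the lattice points of [K] are
    pairwise disjoint, as the centers of two copies that met would differ by an
    element of [2 t K], and they are contained in [(1 + t) K]. *)
Lemma lattice_packing (t : R) : 0 < t -> 2 * t < lambda1 ->
  N%:R * (t ^+ d * autocorrelation K 0) <= (1 + t) ^+ d * fine (lebesgue_rV K).
Proof.
move=> t0 tl; have [_ Kconv _] := hK.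
have [l0 lmin] := first_successive_minimum_spec.
have mK := body_measurable hK.
pose C := overlap K 0.
have mC : measurable C by exact: measurable_overlap.
pose S := fset_set (K `&` @integer_lattice R d).
have SP z : z \in S -> K z /\ integer_lattice z.
  by rewrite /S (in_fset_set lattice_points_finite) => /set_mem.
pose P z := [set t *: x + z | x in C].
have mP z : measurable (P z) by exact: measurable_affine_image.
have tP : trivIset [set` S] P.
  move=> z w /SP[_ zZ] /SP[_ wZ] [_ [[x [Kx Kx'] <-] [y [Ky Ky'] E]]].
  apply/eqP; rewrite -subr_eq0; apply/eqP.
  apply: (lmin (2 * t)) => //; [by rewrite mulr_gt0|exact: integer_latticeB|].
  have -> : z - w = t *: (y - x).
    rewrite scalerBr; apply/eqP; rewrite subr_eq addrAC -subr_eq opprK.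
    by rewrite E addrC.
  rewrite scalerA invfM divfK ?gt_eqF//.
  move: Kx' Ky' => /=; rewrite !sub0r => Kx' Ky'.
  rewrite (_ : _ *: _ = (1 - 2^-1) *: y + 2^-1 *: (- x)).
    by apply: convex_set_comb => //; rewrite invr_ge0 ler0n invf_le1// ler1n.
  by apply/rowP => j; rewrite !mxE; lra.
have PV z : (lebesgue_rV (P z) = (t ^+ d * autocorrelation K 0)%:E)%E.
  by rewrite lebesgue_rV_affine// EFinM -autocorrelationE// -overlap_integral.
have m1 : measurable [set (1 + t) *: x + 0 | x in K].
  by apply: measurable_affine_image => //; rewrite addr_gt0.
have : (lebesgue_rV (\big[setU/set0]_(z <- S) P z) <=
    lebesgue_rV [set ((1 + t) *: x + 0)%R | x in K])%E.
  apply: le_measure.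
  - by apply: mem_set; apply: bigsetU_measurable => z _; exact: mP.
  - exact: mem_set.
  rewrite -bigcup_fset => _ [z /SP[Kz _] [x [Kx _] <-]].
  have t1 : 1 + t != 0 by rewrite gt_eqF// addr_gt0.
  exists ((1 - t / (1 + t)) *: z + (t / (1 + t)) *: x).
    apply: convex_set_comb => //; rewrite divr_ge0 ?addr_ge0 ?(ltW t0)//=.
    by rewrite ler_pdivrMr ?addr_gt0// mul1r; lra.
  by apply/rowP => j; rewrite !mxE; field.
rewrite measure_fbigsetU//.
rewrite (eq_bigr (fun=> (t ^+ d * autocorrelation K 0)%:E)) => [|z _]; last exact: PV.
rewrite lebesgue_rV_affine ?addr_gt0// body_volume_fin// sumEFin -EFinM lee_fin.
by rewrite big_const_seq count_predT iter_addr_0 mulr_natl.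
Qed.

End successive_minimum.

(** * The bound *)

Theorem proposition1p1 (R : realType) (d : nat) (hd : (0 < d)%N)
    (K : set 'rV[R]_d) (hK : convex_body K) (hc : centroid K = 0) :
  (counting (K `&` @integer_lattice R d) <
    (2 ^+ d * (2 / first_successive_minimum K + 1) ^+ d)%:E)%E.
Proof.
have [l0 _] := first_successive_minimum_spec hd hK hc.
set l := first_successive_minimum K in l0 *.
rewrite /counting asboolT; last exact: lattice_points_finite.
rewrite lte_fin; set N := #|` _|.
have V0 := body_volume_gt0 hK; have MP := milman_pajor hd hK hc.
set V := fine _ in V0 MP; set C := autocorrelation K 0 in MP.
have C0 : 0 < C by rewrite -(pmulr_rgt0 _ (exprn_gt0 d (ltr0n R 2))) (lt_trans V0).
have l2 : 0 < l / 2 by rewrite divr_gt0.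
have : (N%:R * C) * (l / 2) ^+ d <= (1 + l / 2) ^+ d * V.
  apply: exprn_le_left_limit => // t t0 tl.
  have := @lattice_packing R d K hd hK hc t t0 _.
  rewrite -/N -/C -/V mulrA mulrAC => /(_ _)/le_trans; apply.
    by rewrite -/l; lra.
  by rewrite ler_wpM2r ?(ltW V0)// lerXn2r ?nnegrE ?addr_ge0// ?ltW// ltrD2l.
move=> H.
have E : 2 / l + 1 = (1 + l / 2) / (l / 2) by field; rewrite gt_eqF.
rewrite E expr_div_n mulrA ltr_pdivlMr ?exprn_gt0//.
rewrite -(ltr_pM2r C0) mulrAC (le_lt_trans H)// mulrC mulrAC ltr_pM2r//.
by rewrite exprn_gt0// addr_gt0.
Qed.
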